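(* Let $X$ be a locally finite building of type $\tilde A_2$. Assume that there is a lattice $\Gamma\le\mathrm{Aut}(X)$ acting regularly on one and hence on all types of panels. Then there are three Singer groups $S_1,S_2,S_3$ associated to the three types of possible vertex links, and three ordered difference sets $d_1,d_2,d_3$ corresponding to these Singer groups satisfying $d_\alpha(0)=1\in S_\alpha$, such that $\Gamma$ admits the presentation $$\Gamma\cong\langle S_1,S_2,S_3\mid\text{all relations in the groups }S_1,S_2,S_3,\quad d_1(j)d_2(j)d_3(j)=1\quad\forall j\in J\rangle .$$
   Context: Buildings are thick. $\mathrm{Aut}(X)$ carries the topology for which stabilisers of compact sets form a neighbourhood basis of the identity; a lattice is a discrete subgroup of finite covolume. ''Regularly'' means transitively and freely: $\Gamma$ acts regularly on the set of panels (edges) of a given type. The vertex links of $X$ are finite projective planes of one common order $q$; put $J=\{0,1,\dots,q\}$. Since $\Gamma$ is transitive on vertices of each type there are, up to isomorphism, three vertex links $\mathcal I_1,\mathcal I_2,\mathcal I_3$, one per vertex type. A Singer group of a finite projective plane is a group of automorphisms acting regularly on points (and then also on lines). For a projective plane $\mathcal I_\alpha$ with Singer group $S_\alpha$, a choice of point $p_\alpha$ and line $l_\alpha$ gives the difference set $D_\alpha=\{d\in S_\alpha:p_\alpha\text{ is incident with }d(l_\alpha)\}$, which has $q+1$ elements; an ordered difference set is a bijection $d_\alpha:J\to D_\alpha$. Here $S_\alpha$ is the stabiliser in $\Gamma$ of a vertex of type $\alpha$, acting on the link of this vertex. *)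

(* Defs.v *)
From HB Require Import structures.
From mathcomp Require Import all_boot all_order all_algebra.
From mathcomp Require Import monoid perm generic_quotient.
From mathcomp Require Import all_classical all_reals all_analysis.

Set Implicit Arguments.
Unset Strict Implicit.
Unset Printing Implicit Defensive.

Import numFieldNormedType.Exports.

Local Open Scope classical_set_scope.
Local Open Scope quotient_scope.
Local Open Scope group_scope.

Definition subgrp (G : groupType) (H : groupClosed G) : Type :=
  {x : G | x \in H}.

HB.instance Definition _ (G : groupType) (H : groupClosed G) :=
  SubChoice.on (@subgrp G H).

Fact subgrp_closed (G : groupType) (H : groupClosed G) : group_closed (fun x : G => x \in H).
Proof. by split; [exact: gpred1 | exact: gpredF]. Qed.

HB.instance Definition _ (G : groupType) (H : groupClosed G) :=
  SubChoice_isSubGroup.Build G (fun x : G => x \in H) (@subgrp G H) (@subgrp_closed G H).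

Definition is_action (G : groupType) (T : Type) (act : G -> T -> T) : Prop :=
  (forall x, act 1 x = x) /\ (forall g h x, act (g * h) x = act g (act h x)).

Definition acts_regularly (G : groupType) (T : Type) (act : G -> T -> T)
    (A : set T) : Prop :=
  [/\ forall g x, A x -> A (act g x),
      forall x y, A x -> A y -> exists g, act g x = y
    & forall g x, A x -> act g x = x -> g = 1].

(* The letter (x, true) stands for x and (x, false) for x^-1. *)
Definition word (X : Type) := seq (X * bool).

Inductive word_eq (X : Type) (R : set (word X)) : word X -> word X -> Prop :=
| word_eq_refl u : word_eq R u u
| word_eq_sym u v : word_eq R u v -> word_eq R v u
| word_eq_trans u v w : word_eq R u v -> word_eq R v w -> word_eq R u w
| word_eq_cancel u x b v :
    word_eq R (u ++ [:: (x, b); (x, ~~ b)] ++ v) (u ++ v)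
| word_eq_relator u r v : R r -> word_eq R (u ++ r ++ v) (u ++ v).

Section Presented.
Variables (X : choiceType) (R : set (word X)).

Definition word_eqb : rel (word X) := fun u v => `[< word_eq R u v >].

Lemma word_eqb_refl : reflexive word_eqb.
Proof. by move=> u; apply/asboolP; exact: word_eq_refl. Qed.

Lemma word_eqb_sym : symmetric word_eqb.
Proof.
by move=> u v; apply/asboolP/asboolP => h; exact: word_eq_sym.
Qed.

Lemma word_eqb_trans : transitive word_eqb.
Proof.
move=> v u w /asboolP uv /asboolP vw; apply/asboolP.
exact: word_eq_trans uv vw.
Qed.

Canonical word_equiv := EquivRel word_eqb word_eqb_refl word_eqb_sym
  word_eqb_trans.

(* The group < X | R >. *)
Definition presented : Type := {eq_quot word_equiv}.

HB.instance Definition _ := Choice.on presented.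
HB.instance Definition _ := Quotient.on presented.

Lemma presentedP (u v : word X) :
  (\pi_presented u = \pi_presented v) <-> word_eq R u v.
Proof.
split => [/eqmodP/asboolP //|h].
by apply/eqmodP/asboolP.
Qed.

Definition word_inv (u : word X) : word X :=
  rev [seq (x.1, ~~ x.2) | x <- u].

Definition pres_one : presented := \pi_presented [::].
Definition pres_mul (g h : presented) : presented :=
  \pi_presented (repr g ++ repr h).
Definition pres_inv (g : presented) : presented :=
  \pi_presented (word_inv (repr g)).

Lemma word_eq_catl w u v : word_eq R u v -> word_eq R (w ++ u) (w ++ v).
Proof.
elim=> [u'|u' v' _ ih|u' v' w' _ ih1 _ ih2|u' x b v'|u' r v' Rr].
- exact: word_eq_refl.
- exact: word_eq_sym.
- exact: word_eq_trans ih1 ih2.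
- by rewrite !(catA w); exact: word_eq_cancel.
- by rewrite !(catA w); exact: word_eq_relator.
Qed.

Lemma word_eq_catr w u v : word_eq R u v -> word_eq R (u ++ w) (v ++ w).
Proof.
elim=> [u'|u' v' _ ih|u' v' w' _ ih1 _ ih2|u' x b v'|u' r v' Rr].
- exact: word_eq_refl.
- exact: word_eq_sym.
- exact: word_eq_trans ih1 ih2.
- by rewrite -!catA; exact: word_eq_cancel.
- by rewrite -!catA; exact: word_eq_relator.
Qed.

Lemma word_eq_invl u : word_eq R (word_inv u ++ u) [::].
Proof.
elim: u => [|[x b] u ih]; first exact: word_eq_refl.
rewrite /word_inv map_cons rev_cons -cats1 -catA /=.
have := word_eq_cancel R (word_inv u) x (~~ b) u.
by rewrite negbK /= => h; exact: word_eq_trans h ih.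
Qed.

Lemma word_invK : involutive word_inv.
Proof.
move=> u; rewrite /word_inv map_rev revK -map_comp -[RHS]map_id.
by apply: eq_map => -[x b] /=; rewrite negbK.
Qed.

Lemma word_eq_invr u : word_eq R (u ++ word_inv u) [::].
Proof. by have := word_eq_invl (word_inv u); rewrite word_invK. Qed.

Lemma word_eq_repr u : word_eq R (repr (\pi_presented u)) u.
Proof. by apply/presentedP; rewrite reprK. Qed.

Lemma pres_mulE u v :
  pres_mul (\pi_presented u) (\pi_presented v) = \pi_presented (u ++ v).
Proof.
rewrite /pres_mul; apply/presentedP; apply: word_eq_trans (word_eq_catl _ (word_eq_repr v)).
exact/word_eq_catr/word_eq_repr.
Qed.

Lemma pres_mulA : associative pres_mul.
Proof.
elim/quotW=> u; elim/quotW=> v; elim/quotW=> w.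
by rewrite (pres_mulE v) (pres_mulE u v) !pres_mulE catA.
Qed.

Lemma pres_mul1 : left_id pres_one pres_mul.
Proof. by elim/quotW=> u; rewrite pres_mulE. Qed.

Lemma pres_mulr1 : right_id pres_one pres_mul.
Proof. by elim/quotW=> u; rewrite pres_mulE cats0. Qed.

Lemma pres_mulV : left_inverse pres_one pres_inv pres_mul.
Proof.
move=> g; rewrite -{2}[g]reprK pres_mulE.
exact/presentedP/word_eq_invl.
Qed.

Lemma pres_mulrV : right_inverse pres_one pres_inv pres_mul.
Proof.
move=> g; rewrite -{1}[g]reprK pres_mulE.
exact/presentedP/word_eq_invr.
Qed.

HB.instance Definition _ := isGroup.Build presented
  pres_mulA pres_mul1 pres_mulr1 pres_mulV pres_mulrV.

Definition pres_gen (x : X) : presented := \pi_presented [:: (x, true)].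

End Presented.

Definition letter_eval (G : groupType) (X : Type) (f : X -> G) (x : X * bool) :
    G :=
  if x.2 then f x.1 else (f x.1)^-1.

Definition word_eval (G : groupType) (X : Type) (f : X -> G) (w : word X) : G :=
  \prod_(x <- w) letter_eval f x.

Definition atilde2_matrix (i j : 'I_3) : nat := if i == j then 1%N else 3%N.

Definition atilde2_relators : set (word 'I_3) :=
  [set w | exists i j : 'I_3,
     w = flatten (nseq (atilde2_matrix i j) [:: (i, true); (j, true)])].

Definition W : groupType := presented atilde2_relators.

Definition refl (i : 'I_3) : W := pres_gen atilde2_relators i.

Definition refl_prod (u : seq 'I_3) : W := \prod_(i <- u) refl i.

Definition has_length (w : W) (n : nat) : Prop :=
  (exists2 u, size u = n & refl_prod u = w) /\
  (forall u, refl_prod u = w -> (n <= size u)%N).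

Definition parabolic (J : {set 'I_3}) : set W :=
  [set w | exists2 u : seq 'I_3, {subset u <= J} & refl_prod u = w].

(* A building of type (W, S), W the Coxeter group of type ~A_2, as a set of
   chambers with a W-valued distance. dist_step and dist_step_up together form
   the second axiom of W-metric spaces, the length condition being
   l(s_i w) = l(w) + 1. Thickness is a separate predicate. *)
Record building := Building {
  chamber :> Type ;
  dist : chamber -> chamber -> W ;
  chamber_inhabited : inhabited chamber ;
  dist_eq1 : forall c d, dist c d = 1 <-> c = d ;
  dist_step : forall c d c' i, dist c' c = refl i ->
    dist c' d = refl i * dist c d \/ dist c' d = dist c d ;
  dist_step_up : forall c d c' i n, dist c' c = refl i ->
    has_length (dist c d) n -> has_length (refl i * dist c d) n.+1 ->
    dist c' d = refl i * dist c d ;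
  dist_exists : forall c d i,
    exists2 c', dist c' c = refl i & dist c' d = refl i * dist c d
}.

(* Simplices are residues: the face of c whose vertices have the types outside
   J is the J-residue of c, i.e. the set of chambers containing that face. *)
Definition residue (X : building) (J : {set 'I_3}) (c : X) : set X :=
  [set d | parabolic J (dist c d)].

Definition vertex_of (X : building) (c : X) (a : 'I_3) : set X :=
  residue (~: [set a])%SET c.

Definition panel_of (X : building) (c : X) (i : 'I_3) : set X :=
  residue [set i]%SET c.

Definition vertices (X : building) (a : 'I_3) : set (set X) :=
  [set vertex_of c a | c in [set: X]].

(* The panels (edges) whose two vertices have the types different from i. *)
Definition panels (X : building) (i : 'I_3) : set (set X) :=
  [set panel_of c i | c in [set: X]].

Arguments vertices : clear implicits.
Arguments panels : clear implicits.

Definition thick (X : building) : Prop :=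
  forall i (P : set X), panels X i P ->
    exists c d e : X, [/\ P c, P d & P e] /\ [/\ c <> d, c <> e & d <> e].

Definition locally_finite (X : building) : Prop :=
  forall a (v : set X), vertices X a v -> finite_set v.

(* f maps i-adjacent chambers to s(i)-adjacent ones for some permutation s of
   the types, as simplicial automorphisms need not preserve types. *)
Definition permutes_types (X : building) (f : X -> X) : Prop :=
  exists s : 'S_3, forall i c d,
    panel_of c i d <-> panel_of (f c) (s i) (f d).

Record aut (X : building) : Type := Aut {
  aut_fun :> X -> X ;
  aut_inv : X -> X ;
  aut_funK : cancel aut_fun aut_inv ;
  aut_invK : cancel aut_inv aut_fun ;
  aut_types : permutes_types aut_fun
}.

Section AutGroup.
Variable X : building.

HB.instance Definition _ := gen_eqMixin (aut X).
HB.instance Definition _ := gen_choiceMixin (aut X).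

Lemma aut_eq (g h : aut X) : g =1 h -> g = h.
Proof.
case: g h => [g g' gK g'K gt] [h h' hK h'K ht] /= /funext gh.
rewrite {}gh in gK g'K gt *.
have e : g' = h' by apply/funext => x; rewrite -[x]h'K gK hK.
by rewrite {}e in gK g'K *; congr Aut; exact: Prop_irrelevance.
Qed.

Lemma aut_one_types : permutes_types (@id X).
Proof. by exists 1 => i c d; rewrite perm1. Qed.

Lemma aut_mul_types (g h : aut X) : permutes_types (g \o h).
Proof.
have [s sP] := aut_types g; have [t tP] := aut_types h.
by exists (t * s) => i c d; rewrite permM /= -sP -tP.
Qed.

Lemma aut_inv_types (g : aut X) : permutes_types (aut_inv g).
Proof.
have [s sP] := aut_types g.
exists s^-1 => i c d.
by rewrite [X in _ <-> X]sP permKV !aut_invK.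
Qed.

Definition aut_one : aut X := Aut (frefl id) (frefl id) aut_one_types.
Definition aut_mul (g h : aut X) : aut X :=
  Aut (can_comp (@aut_funK _ g) (@aut_funK _ h))
      (can_comp (@aut_invK _ h) (@aut_invK _ g)) (aut_mul_types g h).
Definition aut_opp (g : aut X) : aut X :=
  Aut (@aut_invK _ g) (@aut_funK _ g) (aut_inv_types g).

Lemma aut_mulA : associative aut_mul.
Proof. by move=> f g h; exact: aut_eq. Qed.
Lemma aut_mul1 : left_id aut_one aut_mul.
Proof. by move=> g; exact: aut_eq. Qed.
Lemma aut_mulr1 : right_id aut_one aut_mul.
Proof. by move=> g; exact: aut_eq. Qed.
Lemma aut_mulV : left_inverse aut_one aut_opp aut_mul.
Proof. by move=> g; apply: aut_eq => x /=; rewrite aut_funK. Qed.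
Lemma aut_mulrV : right_inverse aut_one aut_opp aut_mul.
Proof. by move=> g; apply: aut_eq => x /=; rewrite aut_invK. Qed.

HB.instance Definition _ := isGroup.Build (aut X)
  aut_mulA aut_mul1 aut_mulr1 aut_mulV aut_mulrV.

End AutGroup.

Definition aut_act (X : building) (g : aut X) (A : set X) : set X := g @` A.

Lemma aut_act1 (X : building) (A : set X) : aut_act 1 A = A.
Proof. exact: image_id. Qed.

Lemma aut_actM (X : building) (g h : aut X) (A : set X) :
  aut_act (g * h) A = aut_act g (aut_act h A).
Proof. by rewrite /aut_act -image_comp. Qed.

Definition stab_pred (X : building) (Gamma : groupClosed (aut X)) (v : set X) :
    {pred aut X} :=
  [pred g | (g \in Gamma) && `[< aut_act g v = v >]].

Section Stab.
Variables (X : building) (Gamma : groupClosed (aut X)) (v : set X).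

Fact stab_pred1 : 1 \in stab_pred Gamma v.
Proof. by rewrite inE gpred1; apply/asboolP; exact: aut_act1. Qed.

Fact stab_predM : mulg_closed (stab_pred Gamma v).
Proof.
move=> g h; rewrite !inE => /andP[Gg /asboolP gv] /andP[Gh /asboolP hv].
by rewrite gpredM //; apply/asboolP; rewrite aut_actM hv.
Qed.

Fact stab_predV : invg_closed (stab_pred Gamma v).
Proof.
move=> g; rewrite !inE => /andP[Gg /asboolP gv].
rewrite gpredVr //; apply/asboolP.
by rewrite -[in LHS]gv -aut_actM mulVg aut_act1.
Qed.

HB.instance Definition _ := isMulClosed.Build (aut X) (stab_pred Gamma v) stab_predM.
HB.instance Definition _ := isMul1Closed.Build (aut X) (stab_pred Gamma v) stab_pred1.
HB.instance Definition _ := isInvClosed.Build (aut X) (stab_pred Gamma v) stab_predV.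

Definition stab : groupClosed (aut X) := stab_pred Gamma v.

End Stab.

Definition panel_regular (X : building) (Gamma : groupClosed (aut X))
    (i : 'I_3) : Prop :=
  acts_regularly (fun g : subgrp Gamma => aut_act (val g)) (panels X i).

(* Points are given by their barycentric coordinates, a function on vertices
   (extended by 0 to all sets of chambers). For locally finite X the usual
   topology is that of pointwise convergence of the coordinates. *)
Definition realization (R : realType) (X : building) : set {ptws set X -> R} :=
  [set x | exists c : X,
     [/\ forall a, (0 <= x (vertex_of c a))%R,
         (\sum_(a < 3) x (vertex_of c a) = 1)%R
       & forall v, (forall a, v <> vertex_of c a) -> x v = 0%R]].

Arguments realization : clear implicits.

(* g fixes K pointwise; g acts on coordinates by (g x)(v) = x(g^-1 v). *)
Definition fixes (R : realType) (X : building) (g : aut X)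
    (K : set {ptws set X -> R}) : Prop :=
  forall x, K x -> (fun v => x (aut_act g^-1 v)) = x.

(* The pointwise stabilisers of compact sets are the basic neighbourhoods of 1. *)
Definition aut_open (R : realType) (X : building) : set (set (aut X)) :=
  [set U | forall g, U g -> exists K : set {ptws set X -> R},
     [/\ K `<=` realization R X, compact K
       & forall h : aut X, fixes h K -> U (g * h)]].

Arguments aut_open : clear implicits.

Definition discrete_subgroup (R : realType) (X : building)
    (Gamma : groupClosed (aut X)) : Prop :=
  forall g, g \in Gamma ->
    exists2 U, aut_open R X U & U `&` [set` Gamma] = [set g].

Section Cosets.
Variables (G : groupType) (H : groupClosed G).

Definition coset_rel : rel G := fun x y => x^-1 * y \in H.

Lemma coset_rel_refl : reflexive coset_rel.
Proof. by move=> x; rewrite /coset_rel mulVg gpred1. Qed.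

Lemma coset_rel_sym : symmetric coset_rel.
Proof. by move=> x y; rewrite /coset_rel -gpredV invgM invgK. Qed.

Lemma coset_rel_trans : transitive coset_rel.
Proof.
move=> y x z xy yz; rewrite /coset_rel.
by rewrite -[z](mulKg y^-1) invgK mulgA gpredM.
Qed.

Canonical coset_equiv := EquivRel coset_rel coset_rel_refl coset_rel_sym
  coset_rel_trans.

(* The space G / H of the left cosets xH. *)
Definition cosets : Type := {eq_quot coset_equiv}.

HB.instance Definition _ := Choice.on cosets.
HB.instance Definition _ := Quotient.on cosets.
HB.instance Definition _ := isPointed.Build cosets (\pi_cosets 1).

Definition translate (g : G) (x : cosets) : cosets := \pi_cosets (g * repr x).

End Cosets.

(* The quotient topology on Aut(X) / Gamma. *)
Definition cosets_open (R : realType) (X : building)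
    (Gamma : groupClosed (aut X)) : set (set (cosets Gamma)) :=
  [set U | aut_open R X (\pi_(cosets Gamma) @^-1` U)].

Arguments cosets_open R [X] Gamma.

(* Aut(X) / Gamma carries a nonzero finite Aut(X)-invariant Borel measure. *)
Definition finite_covolume (R : realType) (X : building)
    (Gamma : groupClosed (aut X)) : Prop :=
  exists mu : ({measure set (g_sigma_algebraType (cosets_open R Gamma)) ->
                        \bar R})%R,
    [/\ (0 < mu [set: cosets Gamma])%E, (mu [set: cosets Gamma] < +oo)%E
      & forall (g : aut X) (A : set (cosets Gamma)),
          (cosets_open R Gamma).-sigma.-measurable A ->
          mu (translate g @` A) = mu A].

Definition lattice (R : realType) (X : building)
    (Gamma : groupClosed (aut X)) : Prop :=
  discrete_subgroup R Gamma /\ finite_covolume R Gamma.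

Record incidence_structure (T : Type) := IncidenceStructure {
  points : set T ;
  lines : set T ;
  incident : T -> T -> Prop
}.

Definition collinear (T : Type) (I : incidence_structure T) (x y z : T) :=
  exists2 l, lines I l & [/\ incident I x l, incident I y l & incident I z l].

Definition projective_plane (T : Type) (I : incidence_structure T) (q : nat) :
    Prop :=
  [/\ forall x y, points I x -> points I y -> x <> y ->
        exists! l, [/\ lines I l, incident I x l & incident I y l],
      forall l m, lines I l -> lines I m -> l <> m ->
        exists! x, [/\ points I x, incident I x l & incident I x m],
      exists w x y z,
        [/\ points I w, points I x, points I y & points I z] /\
        [/\ ~ collinear I w x y, ~ collinear I w x z,
            ~ collinear I w y z & ~ collinear I x y z]
    & forall l, lines I l ->
        ([set x | points I x /\ incident I x l] #= `I_q.+1)%card].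

Definition singer_group (T : Type) (I : incidence_structure T)
    (S : groupType) (act : S -> T -> T) : Prop :=
  [/\ is_action act,
      forall s l, lines I l -> lines I (act s l),
      forall s x l, points I x -> lines I l ->
        (incident I (act s x) (act s l) <-> incident I x l)
    & acts_regularly act (points I)].

Definition difference_set (T : Type) (I : incidence_structure T)
    (S : groupType) (act : S -> T -> T) (p l : T) : set S :=
  [set s | incident I p (act s l)].

Definition ordered_difference_set (T : Type) (I : incidence_structure T)
    (S : groupType) (act : S -> T -> T) (q : nat) (d : 'I_q.+1 -> S) : Prop :=
  exists p l, [/\ points I p, lines I l
    & set_bij [set: 'I_q.+1] (difference_set I act p l) d].

(* The vertices of the link of v are the panels containing v. With the vertex
   types in cyclic order, the points of the link of a vertex of type a are the
   edges joining it to vertices of type a - 1, i.e. the panels in panels (a + 1),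
   and its lines are the edges to vertices of type a + 1. The same cyclic
   convention at all three types is what makes the relations read d1 d2 d3 = 1
   rather than involve inverses. *)
Definition link (X : building) (a : 'I_3) (v : set X) :
    incidence_structure (set X) :=
  {| points := [set P | panels X (ordS a) P /\ P `<=` v] ;
     lines := [set P | panels X (ord_pred a) P /\ P `<=` v] ;
     incident := fun P Q => P `&` Q !=set0 |}.

Definition stab_act (X : building) (Gamma : groupClosed (aut X)) (v : set X)
    (s : subgrp (stab Gamma v)) (P : set X) : set X :=
  aut_act (val s) P.

Section Relations.
Variables (X : building) (Gamma : groupClosed (aut X)) (v : 'I_3 -> set X).
Variables (q : nat) (d : forall a, 'I_q.+1 -> subgrp (stab Gamma (v a))).

(* The disjoint union of the three groups. *)
Definition generators : choiceType :=
  {a : 'I_3 & subgrp (stab Gamma (v a))}.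

Definition generator (a : 'I_3) (s : subgrp (stab Gamma (v a))) : generators :=
  Tagged (fun a => subgrp (stab Gamma (v a))) s.

(* All words in the letters of one group S_a that evaluate to 1 in S_a. *)
Definition group_relators : set (word generators) :=
  [set r | exists a (w : word (subgrp (stab Gamma (v a)))),
     word_eval id w = 1 /\ r = [seq (generator x.1, x.2) | x <- w]].

(* enum 'I_3 is [:: 0; 1; 2], so these are the words d1(j) d2(j) d3(j). *)
Definition triangle_relators : set (word generators) :=
  [set r | exists j : 'I_q.+1,
     r = [seq (generator (d a j), true) | a <- enum 'I_3]].

Definition singer_presentation : groupType :=
  presented (group_relators `|` triangle_relators).

Definition singer_presentation_gen (a : 'I_3)
    (s : subgrp (stab Gamma (v a))) : singer_presentation :=
  pres_gen (group_relators `|` triangle_relators) (generator s).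

End Relations.

(* Main.v *)
Require Import Defs.
From HB Require Import structures.
From mathcomp Require Import all_boot all_order all_algebra.
From mathcomp Require Import monoid perm generic_quotient.
From mathcomp Require Import all_classical all_reals all_analysis.

(** Label the panels of X by elements of Gamma. Fix a chamber o; by regularity every
panel of type i is the translate of the panel of type i of o by a unique element,
so a chamber c has three coordinates gam i c in Gamma, one for each of its panels.
Two panels of c meet in a vertex of type a, hence the corresponding coordinates
differ by an element of the stabiliser S_a of the vertex of type a of o. As c runs
through the q + 1 chambers of one panel of o, these differences run through a
difference set of S_a, simultaneously for the three types a, and they telescope:
their product is 1. This gives the three difference sets, ordered by one and the
same enumeration of these q + 1 chambers, and the relations d1 d2 d3 = 1.

That these relations suffice is the simple connectedness of X. In the group
presented by the S_a and the triangle relations, the coordinates of a chamber can be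
lifted as soon as one of them is, and a lift propagates over all chambers
containing a given vertex, consistently because all relations of S_a hold.
The lifts thus form a cocycle on pairs of chambers sharing a vertex, and
trivial_cocycle gives a global lift; it is proved by transport along minimal
galleries from o, using the gate of each residue. The global lift provides an inverse
of the map from the presented group to Gamma (eval_map_bij). The Coxeter group
enters through its presentation only, so the exchange condition is first derived
from it (exchange), by counting wall crossings modulo 2.

Two things must be known beforehand. Vertex links are projective planes, all of
the same order q (vertex_plane_projective, panel_card_neq). And Gamma is
regular on the panels of all types once it is on those of one type. The elements of
Gamma might exchange the two other types; this is excluded because it would split the
q^2 + q + 1 points of a vertex link, an odd number, into two classes of equal size
(type_preserving). Then a vertex stabiliser that is regular on the points of the
link is regular on its lines, because q^2 + q + 1 and q + 1 are coprime
(regular_on_lines, regular_other). *)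

Set Implicit Arguments.
Unset Strict Implicit.
Unset Printing Implicit Defensive.

Local Open Scope classical_set_scope.
Local Open Scope quotient_scope.
Local Open Scope group_scope.

(** * Homomorphisms out of a presented group *)

Lemma pi_catM (Y : choiceType) (R : set (word Y)) (u v : word Y) :
  \pi_(presented R) (u ++ v) = \pi_(presented R) u * \pi_(presented R) v.
Proof. by symmetry; exact: pres_mulE. Qed.

Section PresentedHom.
Variables (Y : choiceType) (R : set (word Y)) (G : groupType) (f : Y -> G).

Lemma word_eval_cat (u v : word Y) :
  word_eval f (u ++ v) = word_eval f u * word_eval f v.
Proof. by rewrite /word_eval big_cat. Qed.

Lemma word_eval_cons x (u : word Y) :
  word_eval f (x :: u) = letter_eval f x * word_eval f u.
Proof. by rewrite /word_eval big_cons. Qed.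

Hypothesis fR : forall r, R r -> word_eval f r = 1.

Lemma word_eval_eq u v : word_eq R u v -> word_eval f u = word_eval f v.
Proof.
elim=> // [u' v' w' _ -> _ -> //|u' x b v'|u' r v' Rr].
- rewrite !word_eval_cat !word_eval_cons /letter_eval /= /word_eval big_nil.
  by case: b; rewrite /= mulg1; [rewrite mulgV|rewrite mulVg]; rewrite mul1g.
- by rewrite !word_eval_cat (fR Rr) mul1g.
Qed.

(** The homomorphism given by f on generators, once f kills the relators. *)
Definition pres_lift (x : presented R) : G := word_eval f (repr x).

Lemma pres_lift_pi w : pres_lift (\pi_(presented R) w) = word_eval f w.
Proof. exact/word_eval_eq/word_eq_repr. Qed.

Lemma pres_liftM : {morph pres_lift : x y / x * y}.
Proof.
elim/quotW=> u; elim/quotW=> v.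
by rewrite -pi_catM !pres_lift_pi word_eval_cat.
Qed.

Lemma pres_lift_gen y : pres_lift (pres_gen R y) = f y.
Proof. by rewrite pres_lift_pi /word_eval big_seq1. Qed.

End PresentedHom.

Lemma pi_word_eval (Y : choiceType) (R : set (word Y)) (w : word Y) :
  \pi_(presented R) w = word_eval (pres_gen R) w.
Proof.
elim: w => [|[y b] w ih]; first by rewrite /word_eval big_nil.
rewrite word_eval_cons -ih -cat1s pi_catM; congr (_ * _).
case: b => //; rewrite /letter_eval /=.
apply: (mulgI (pres_gen R y)); rewrite mulgV /pres_gen -pi_catM.
by apply/presentedP; exact: (@word_eq_cancel _ _ [::] y true [::]).
Qed.

(** * The three types *)

Lemma other_type (i k : 'I_3) : exists2 a, i != a & k != a.
Proof.
case: i k => -[|[|[|//]]] ? [] [|[|[|//]]] ? //=;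
  by [exists (Ordinal (isT : 0 < 3)%N) | exists (Ordinal (isT : 1 < 3)%N)
     | exists (Ordinal (isT : 2 < 3)%N)].
Qed.

Lemma third_type_uniq (i k a b : 'I_3) :
  i != k -> i != a -> k != a -> i != b -> k != b -> a = b.
Proof.
move=> ik ia ka ib kb; apply/val_inj; move: ik ia ka ib kb.
by case: i k a b => -[|[|[|//]]] ? [] [|[|[|//]]] ? [] [|[|[|//]]] ? []
  [|[|[|//]]] ?.
Qed.

Lemma compl_set3 (i j a : 'I_3) (ij : i != j) (ia : i != a) (ja : j != a) :
  (~: [set a])%SET = [set i; j]%SET.
Proof.
apply/setP => k; rewrite !inE.
by case: i j a k ij ia ja => -[|[|[|//]]] ? [] [|[|[|//]]] ? [] [|[|[|//]]] ? []
  [|[|[|//]]] ?.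
Qed.

Lemma ordS_neq (a : 'I_3) : ordS a != a.
Proof. by case: a => -[|[|[|//]]]. Qed.

Lemma ord_pred_neq (a : 'I_3) : ord_pred a != a.
Proof. by case: a => -[|[|[|//]]]. Qed.

Lemma ordS_pred_neq (a : 'I_3) : ordS a != ord_pred a.
Proof. by case: a => -[|[|[|//]]]. Qed.

Lemma neq_ord3 (i a : 'I_3) : i != a -> i = ordS a \/ i = ord_pred a.
Proof.
by case: i a => -[|[|[|//]]] ? [] [|[|[|//]]] ? //= _;
  do ?[by left; apply: val_inj | by right; apply: val_inj].
Qed.

Lemma enum_I3 : enum 'I_3 = [:: ord0; ordS ord0; ord_pred ord0].
Proof. by apply: (inj_map val_inj); rewrite val_enum_ord. Qed.

Lemma nontrivial_fix (s : 'S_3) (i k : 'I_3) :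
  s i = i -> s != 1 -> i != k -> (i != s k) * (k != s k).
Proof.
move=> si s1 ik; have isk : i != s k by rewrite -{1}si (inj_eq perm_inj).
split=> //; apply: contraNneq s1 => ksk.
have [a ia ka] := other_type i k; apply/eqP/permP => m; rewrite perm1.
have isa : i != s a by rewrite -{1}si (inj_eq perm_inj).
have ksa : k != s a by rewrite {1}ksk (inj_eq perm_inj).
have sa : s a = a by symmetry; exact: third_type_uniq ik ia ka isa ksa.
have [<-//|im] := eqVneq i m; have [<-//|km] := eqVneq k m.
by rewrite -(third_type_uniq ik ia ka im km).
Qed.

(** The transposition of the two other types is the only nontrivial permutation
fixing the type i. *)
Lemma fix_perm_eq (s t : 'S_3) i : s i = i -> t i = i -> s != 1 -> t != 1 -> s = t.
Proof.
move=> si ti s1 t1; apply/permP => k; have [<-|ik] := eqVneq i k; first by rewrite si ti.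
have [is_ ks] := nontrivial_fix si s1 ik; have [it kt] := nontrivial_fix ti t1 ik.
exact: third_type_uniq ik is_ ks it kt.
Qed.

(** * Word length in the Coxeter group *)

Lemma refl_prod_cons i u : refl_prod (i :: u) = refl i * refl_prod u.
Proof. by rewrite /refl_prod big_cons. Qed.

Lemma refl_prod_cat u v : refl_prod (u ++ v) = refl_prod u * refl_prod v.
Proof. by rewrite /refl_prod big_cat. Qed.

Lemma refl_prod_nil : refl_prod [::] = 1.
Proof. by rewrite /refl_prod big_nil. Qed.

Lemma refl_prod1 i : refl_prod [:: i] = refl i.
Proof. by rewrite /refl_prod big_seq1. Qed.

Lemma atilde2_relator1 (r : word 'I_3) :
  atilde2_relators r -> word_eval refl r = 1.
Proof.
move=> Rr; rewrite /refl -pi_word_eval; apply/presentedP.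
by have := word_eq_relator [::] [::] Rr; rewrite cats0.
Qed.

Lemma refl2 i : refl i * refl i = 1.
Proof.
have : atilde2_relators [:: (i, true); (i, true)].
  by exists i, i; rewrite /atilde2_matrix eqxx.
by move/atilde2_relator1; rewrite /word_eval !big_cons big_nil mulg1.
Qed.

Lemma reflK i (w : W) : refl i * (refl i * w) = w.
Proof. by rewrite mulgA refl2 mul1g. Qed.

Lemma reflV i : (refl i)^-1 = refl i.
Proof. by apply: (mulgI (refl i)); rewrite mulgV refl2. Qed.

Lemma refl_braid i j : i != j ->
  refl i * (refl j * refl i) = refl j * (refl i * refl j).
Proof.
move=> ij.
have : atilde2_relators [:: (i, true); (j, true); (i, true); (j, true);
                            (i, true); (j, true)].
  by exists i, j; rewrite /atilde2_matrix (negbTE ij).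
move/atilde2_relator1; rewrite /word_eval !big_cons big_nil mulg1 /letter_eval /=.
move=> e; by rewrite -[RHS]mul1g -e -!mulgA !reflK refl2 mulg1.
Qed.

Lemma word_refl_prod (w : word 'I_3) :
  \pi_(presented atilde2_relators) w = refl_prod (unzip1 w).
Proof.
rewrite pi_word_eval; elim: w => [|[i b] w ih].
  by rewrite /word_eval /refl_prod !big_nil.
by rewrite /= word_eval_cons refl_prod_cons ih; case: b; rewrite //= /letter_eval /= reflV.
Qed.

Lemma refl_prod_surj (w : W) : exists u, refl_prod u = w.
Proof.
by elim/quotW: w => w; exists (unzip1 w); rewrite -word_refl_prod.
Qed.

(** Let s be a reflection of W. A word spells a walk through the chambers of the
Coxeter complex, and the parity of the number of times the walk crosses the wall
of s depends only on the endpoints of the walk. This is that parity for any t,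
not only for reflections: it counts the prefixes u1 i of u, modulo 2, with
t = (u1) i (u1)^-1. It is invariant under the defining relations, hence is a
function on W, and this is what makes the exchange condition provable from the
presentation alone. *)
Fixpoint flip_parity (u : seq 'I_3) (t : W) : bool :=
  if u is i :: u' then (t == refl i) (+) flip_parity u' (refl i * (t * refl i))
  else false.

Lemma flip_parity_cat u v t : flip_parity (u ++ v) t =
  flip_parity u t (+) flip_parity v ((refl_prod u)^-1 * (t * refl_prod u)).
Proof.
elim: u t => [|i u ih] t /=.
  by rewrite refl_prod_nil invg1 mul1g mulg1.
by rewrite ih addbA refl_prod_cons invgM reflV !mulgA.
Qed.

Lemma conj_refl_eq i (t w : W) :
  (refl i * (t * refl i) == w) = (t == refl i * (w * refl i)).
Proof.
apply/eqP/eqP => [<-|->].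
  by rewrite -!mulgA refl2 mulg1 reflK.
by rewrite -!mulgA refl2 mulg1 reflK.
Qed.

(** The six conjugates attached to the relator (i j)^3 are the three reflections of
the dihedral group, each met twice. *)
Lemma flip_parity_relator (r : word 'I_3) t :
  atilde2_relators r -> flip_parity (unzip1 r) t = false.
Proof.
case=> i [j ->]; rewrite /atilde2_matrix; case: eqP => [<-|/eqP ij] /=.
  by rewrite conj_refl_eq refl2 mulg1 addbF addbb.
rewrite !conj_refl_eq -!mulgA.
have br x : refl i * (refl j * (refl i * x)) = refl j * (refl i * (refl j * x)).
  by have := congr1 (fun y => y * x) (refl_braid ij); rewrite -!mulgA.
rewrite !(br, reflK, refl2, mulg1).
move: (t == refl i) (t == refl j) (t == refl i * (refl j * refl i)).
by do 3!case.
Qed.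

Lemma flip_parity_word_eq (u v : word 'I_3) t : word_eq atilde2_relators u v ->
  flip_parity (unzip1 u) t = flip_parity (unzip1 v) t.
Proof.
move=> uv; elim: uv t => // [u' v' w' _ e1 _ e2|u' i b v'|u' r v' Rr] t.
- by rewrite e1 e2.
- rewrite /unzip1 !map_cat /= !flip_parity_cat /=; congr (_ (+) _).
  by rewrite conj_refl_eq refl2 mulg1 addbA addbb /= -!mulgA refl2 mulg1 reflK.
rewrite /unzip1 !map_cat !flip_parity_cat; congr (_ (+) _).
rewrite flip_parity_relator //= -/(unzip1 _) -word_refl_prod pi_word_eval.
by rewrite atilde2_relator1 // invg1 mul1g mulg1.
Qed.

Lemma flip_parity_prod u v t :
  refl_prod u = refl_prod v -> flip_parity u t = flip_parity v t.
Proof.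
have zK (w : seq 'I_3) : unzip1 [seq (i, true) | i <- w] = w.
  by rewrite /unzip1 -map_comp map_id.
rewrite -(zK u) -(zK v) -!word_refl_prod => /presentedP.
exact: flip_parity_word_eq.
Qed.

(** A crossing of the wall of t can be reflected away: multiplication by t deletes
the letter at which it happens. *)
Lemma flip_parity_delete u t : flip_parity u t ->
  exists u1 i u2, u = u1 ++ i :: u2 /\ t * refl_prod u = refl_prod (u1 ++ u2).
Proof.
elim: u t => //= i u ih t; have [-> _|_ /ih] := eqVneq t (refl i).
  by exists [::], i, u; rewrite refl_prod_cons reflK.
case=> u1 [j [u2 [-> e]]]; exists (i :: u1), j, u2; split=> //.
by rewrite /= !refl_prod_cons -e -!mulgA reflK.
Qed.

Definition has_word (w : W) (n : nat) : bool :=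
  `[< exists2 u, size u = n & refl_prod u = w >].

Lemma has_word_ex w : exists n, has_word w n.
Proof.
by have [u <-] := refl_prod_surj w; exists (size u); apply/asboolP; exists u.
Qed.

Definition len (w : W) : nat := ex_minn (has_word_ex w).

Lemma len_word w : exists2 u, size u = len w & refl_prod u = w.
Proof. by rewrite /len; case: ex_minnP => n /asboolP. Qed.

Lemma len_le u : (len (refl_prod u) <= size u)%N.
Proof.
by rewrite /len; case: ex_minnP => n _; apply; apply/asboolP; exists u.
Qed.

Lemma has_length_len w : has_length w (len w).
Proof.
by split; [exact: len_word | move=> u <-; exact: len_le].
Qed.

Lemma len1 : len 1 = 0%N.
Proof. by apply/eqP; rewrite -leqn0 -refl_prod_nil len_le. Qed.

Lemma len_eq0 w : len w = 0%N -> w = 1.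
Proof.
by have [u <- <-] := len_word w => /size0nil ->; exact: refl_prod_nil.
Qed.

Lemma len_reflM_le i w : (len (refl i * w) <= (len w).+1)%N.
Proof.
have [u <- <-] := len_word w.
by rewrite -refl_prod_cons (leq_trans (len_le _)).
Qed.

Lemma flip_parity_reflM i u :
  flip_parity (i :: u) (refl i) = ~~ flip_parity u (refl i).
Proof. by rewrite /= eqxx refl2 mulg1. Qed.

(** Of w and (refl i) w exactly one has odd parity at refl i, and the odd one can be
shortened by deletion. *)
Lemma flip_parity_len i u :
  flip_parity u (refl i) = (len (refl i * refl_prod u) < len (refl_prod u))%N.
Proof.
have lt v : flip_parity v (refl i) ->
    (len (refl i * refl_prod v) < len (refl_prod v))%N.
  have [w sw ew] := len_word (refl_prod v).
  rewrite -(flip_parity_prod _ ew) -ew => /flip_parity_delete[u1 [j [u2 [e ->]]]].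
  by rewrite ew -sw e (leq_ltn_trans (len_le _)) // !size_cat addnS.
apply/idP/idP => [/lt //|]; apply: contraTT; rewrite -flip_parity_reflM => /lt.
by rewrite refl_prod_cons reflK -leqNgt => /ltnW.
Qed.

Lemma len_reflM_cases i w :
  len (refl i * w) = (len w).+1 \/ len w = (len (refl i * w)).+1.
Proof.
have [u <-] := refl_prod_surj w; have := flip_parity_len i u.
have := flip_parity_len i (i :: u); rewrite flip_parity_reflM refl_prod_cons reflK.
have := len_reflM_le i (refl_prod u).
have := len_reflM_le i (refl i * refl_prod u); rewrite reflK => xy yx.
case: flip_parity => /esym h /esym h'; [right | left];
  by apply/eqP; rewrite eqn_leq ?h ?h' ?xy ?yx.
Qed.

(** The exchange condition: if (refl i) w is not longer than w, the wall of refl i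
separates 1 from w, so every word for w contains a letter to be deleted. *)
Lemma exchange i u : (len (refl i * refl_prod u) <= len (refl_prod u))%N ->
  exists u1 k u2, u = u1 ++ k :: u2 /\
    refl i * refl_prod u = refl_prod (u1 ++ u2).
Proof.
move=> le; apply: flip_parity_delete; rewrite flip_parity_len.
by case: (len_reflM_cases i (refl_prod u)) le => ->; rewrite ?ltnn.
Qed.

Lemma reduced_subword u : exists u',
  [/\ {subset u' <= u}, refl_prod u' = refl_prod u
    & len (refl_prod u') = size u'].
Proof.
elim: u => [|i u [u' [sub e red]]]; first by exists [::]; rewrite refl_prod_nil len1.
have sub' : {subset i :: u' <= i :: u}.
  by move=> k; rewrite !inE => /orP[->//|/sub ->]; rewrite orbT.
have [gt|le] := len_reflM_cases i (refl_prod u').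
  by exists (i :: u'); rewrite !refl_prod_cons gt red e.
have [|u1 [k [u2 [eu' e']]]] := @exchange i u'; first by rewrite le.
exists (u1 ++ u2); split.
- move=> m; rewrite mem_cat => mu; apply: sub'; rewrite inE eu' mem_cat inE.
  by case/orP: mu => ->; rewrite ?orbT.
- by rewrite -e' refl_prod_cons e.
- by apply/eqP; rewrite -e' -eqSS -le red eu' !size_cat /= addnS.
Qed.

Lemma refl_prodV u : (refl_prod u)^-1 = refl_prod (rev u).
Proof.
elim: u => [|i u ih]; first by rewrite refl_prod_nil invg1.
by rewrite refl_prod_cons invgM ih reflV rev_cons -cats1 refl_prod_cat refl_prod1.
Qed.

Lemma len_refl_prod_tail i u :
  len (refl_prod (i :: u)) = size (i :: u) -> len (refl_prod u) = size u.
Proof.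
move=> red; apply/eqP; rewrite eqn_leq len_le /= -ltnS.
by rewrite -[X in (X <= _)%N]/(size (i :: u)) -red refl_prod_cons len_reflM_le.
Qed.

(** If a letter of the reduced word u cancelled in u w, the exchange condition would
delete a letter either in u, which is reduced, or in w, which would give a
shorter element of the same coset of the parabolic subgroup. *)
Lemma len_min_coset (J : {set 'I_3}) w :
    (forall u, {subset u <= J} -> (len w <= len (refl_prod u * w))%N) ->
  forall u, {subset u <= J} -> len (refl_prod u) = size u ->
    len (refl_prod u * w) = (size u + len w)%N.
Proof.
move=> wmin; elim=> [|i u ih] sub red; first by rewrite refl_prod_nil mul1g.
have subu : {subset u <= J} by move=> k ku; apply: sub; rewrite inE ku orbT.
have redu := len_refl_prod_tail red.
have := ih subu redu; have [v sv ev] := len_word w.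
rewrite refl_prod_cons -{1 3}ev -mulgA -refl_prod_cat => l.
have [->|le] := len_reflM_cases i (refl_prod (u ++ v)); first by rewrite l.
have := flip_parity_len i (u ++ v); rewrite [in RHS]le ltnSn flip_parity_cat.
rewrite flip_parity_len -refl_prod_cons red redu ltnNge leqnSn /=.
move=> /flip_parity_delete[v1 [k [v2 [e e']]]].
have sub' : {subset rev u ++ i :: u <= J}.
  by move=> m; rewrite mem_cat mem_rev => /orP[/subu //|/sub].
have := wmin _ sub'; rewrite (refl_prod_cat (rev u)) -refl_prodV -{2}ev e'.
by rewrite leqNgt -sv e size_cat /= addnS ltnS -size_cat len_le.
Qed.

(** Distinctness of elements of W is read off in S_3: W maps onto S_3 when the
generators other than i are identified, and every two generators are separated by
such a map for a suitable i. *)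
Definition refl_S3 (i l : 'I_3) : 'S_3 :=
  if l == i then tperm 0%R 1%R else tperm 1%R 2%R.

Lemma refl_S3_relator i r :
  atilde2_relators r -> word_eval (refl_S3 i) r = 1.
Proof.
case=> l [m ->]; rewrite /atilde2_matrix /word_eval /refl_S3.
case: eqVneq => [->|_] /=; rewrite !big_cons big_nil /letter_eval /= mulg1.
  by case: ifP => _; apply: tperm2.
case: ifP => _; case: ifP => _; rewrite !mulgA ?tperm2 ?mul1g ?tperm2 ?mul1g ?tperm2 //;
   apply/permP => x; rewrite !permM perm1.
   by case: x => -[|[|[|//]]] lt; apply: val_inj; rewrite /= !permE /=.
   by case: x => -[|[|[|//]]] lt; apply: val_inj; rewrite /= !permE /=.
Qed.

Definition to_S3 i : W -> 'S_3 := pres_lift (refl_S3 i) (R := atilde2_relators).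

Lemma to_S3M i (w w' : W) : to_S3 i (w * w') = to_S3 i w * to_S3 i w'.
Proof. exact: pres_liftM (@refl_S3_relator i) w w'. Qed.

Lemma to_S3_refl i l : to_S3 i (refl l) = refl_S3 i l.
Proof. exact: pres_lift_gen (@refl_S3_relator i) l. Qed.

Lemma refl_neq1 i : refl i <> 1.
Proof.
move=> e; have := @flip_parity_prod [:: i] [::] (refl i).
by rewrite refl_prod1 refl_prod_nil => /(_ e); rewrite /= eqxx.
Qed.

Lemma refl_inj : injective refl.
Proof.
move=> i j e; apply/eqP/negPn/negP => ij.
have := congr1 (to_S3 i) e; rewrite !to_S3_refl /refl_S3 eqxx eq_sym (negbTE ij).
by move=> /permP/(_ 0%R); rewrite !permE.
Qed.

(** In S_3 the left-hand side is the third transposition, which is not the image of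
a generator. *)
Lemma refl_conj_neq i j k : i != j -> refl i * (refl j * refl i) <> refl k.
Proof.
move=> ij /(congr1 (to_S3 i)); rewrite !to_S3M !to_S3_refl /refl_S3 eqxx.
rewrite (eq_sym j) (negbTE ij); case: ifP => _ /permP.
  by move/(_ 0%R); rewrite !permM !permE.
by move/(_ 1%R); rewrite !permM !permE.
Qed.

Lemma len_refl i : len (refl i) = 1%N.
Proof.
case: (len_reflM_cases i 1); rewrite mulg1 len1 //.
Qed.

Lemma len_refl2 i j : i != j -> len (refl i * refl j) = 2%N.
Proof.
move=> ij; case: (len_reflM_cases i (refl j)); rewrite len_refl // => -[].
move/esym/len_eq0 => e; case/eqP: ij; apply: refl_inj.
by apply: (mulIg (refl j)); rewrite e refl2.
Qed.

Lemma len_refl3 i j : i != j -> len (refl i * (refl j * refl i)) = 3%N.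
Proof.
move=> ij; case: (len_reflM_cases i (refl j * refl i)).
  by rewrite len_refl2 // eq_sym.
rewrite len_refl2 ?(eq_sym j) // => -[]/esym.
have [u <- e] := len_word (refl i * (refl j * refl i)).
case: u e => [//|k [|//]]; rewrite refl_prod1 => /esym e _.
by case: (refl_conj_neq ij e).
Qed.

(** A letter put in front of a word of the list gives again an element of the list, by
the relations i i = 1 and i j i = j i j. *)
Lemma rank2_words i j u : i != j -> {subset u <= [set i; j]%SET} ->
  exists2 v, v \in [:: [::]; [:: i]; [:: j]; [:: i; j]; [:: j; i]; [:: i; j; i]]
    & refl_prod v = refl_prod u.
Proof.
move=> ij; elim: u => [|k u ih] sub; first by exists [::]; rewrite ?inE.
have [|v sv ev] := ih; first by move=> m mu; apply: sub; rewrite inE mu orbT.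
have k_ij : k = i \/ k = j.
  have : k \in [set i; j]%SET by apply: sub; rewrite inE eqxx.
  by rewrite !inE => /orP[]/eqP; [left | right].
have br := refl_braid ij.
have -> : refl_prod (k :: u) = refl_prod (k :: v) by rewrite !refl_prod_cons ev.
move: sv; rewrite !inE.
case: k_ij => ->; do ?[case/orP]; move=> /eqP ->.
- by exists [:: i]; rewrite ?inE ?eqxx /= ?orbT.
- by exists [::]; rewrite ?inE ?eqxx /= ?orbT // !refl_prod_cons refl_prod_nil reflK.
- by exists [:: i; j]; rewrite ?inE ?eqxx /= ?orbT.
- by exists [:: j]; rewrite ?inE ?eqxx /= ?orbT // !refl_prod_cons refl_prod_nil reflK.
- by exists [:: i; j; i]; rewrite ?inE ?eqxx /= ?orbT.
- by exists [:: j; i]; rewrite ?inE ?eqxx /= ?orbT // !refl_prod_cons refl_prod_nil reflK.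
- by exists [:: j]; rewrite ?inE ?eqxx /= ?orbT.
- by exists [:: j; i]; rewrite ?inE ?eqxx /= ?orbT.
- by exists [::]; rewrite ?inE ?eqxx /= ?orbT // !refl_prod_cons refl_prod_nil reflK.
- by exists [:: i; j; i];
    rewrite ?inE ?eqxx /= ?orbT // !refl_prod_cons refl_prod_nil !mulg1 br.
- by exists [:: i]; rewrite ?inE ?eqxx /= ?orbT // !refl_prod_cons refl_prod_nil reflK.
- by exists [:: i; j];
    rewrite ?inE ?eqxx /= ?orbT // !refl_prod_cons refl_prod_nil !mulg1 br reflK.
Qed.

(** * Galleries and residues *)

Section Galleries.
Variable X : building.
Implicit Types (c d e : X) (i j : 'I_3) (u v : seq 'I_3) (J : {set 'I_3}).

Lemma distxx c : dist c c = 1.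
Proof. exact/dist_eq1. Qed.

Lemma dist_refl_sym c d i : dist c d = refl i -> dist d c = refl i.
Proof.
move=> cd; have := dist_step c cd; rewrite distxx.
case=> e; last first.
  by case: (@refl_neq1 i); rewrite -cd; apply/dist_eq1; symmetry; apply/dist_eq1.
by apply: (mulgI (refl i)); rewrite -e refl2.
Qed.

(** Consecutive chambers of these galleries are adjacent and distinct. *)
Fixpoint gallery (u : seq 'I_3) (c d : X) : Prop :=
  if u is i :: u' then exists2 e, dist c e = refl i & gallery u' e d else c = d.

Lemma gallery_cat u v c d e :
  gallery u c d -> gallery v d e -> gallery (u ++ v) c e.
Proof.
elim: u c => [|i u ih] c /=; first by move=> ->.
by case=> c' cc' /ih{}ih /ih; exists c'.
Qed.

Lemma gallery_rev u c d : gallery u c d -> gallery (rev u) d c.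
Proof.
elim: u c => [|i u ih] c /=; first by move=> ->.
case=> c' cc' /ih g; rewrite rev_cons -cats1; apply: gallery_cat g _ => /=.
by exists c => //; exact: dist_refl_sym.
Qed.

Lemma gallery_dist u c d : dist c d = refl_prod u -> gallery u c d.
Proof.
elim: u c => [|i u ih] c /=; first by rewrite refl_prod_nil => /dist_eq1.
rewrite refl_prod_cons => cd; have [c' c'c c'd] := dist_exists c d i.
exists c'; first exact: dist_refl_sym.
by apply: ih; rewrite c'd cd reflK.
Qed.

Lemma dist_up c d e i : dist c d = refl i ->
  len (refl i * dist d e) = (len (dist d e)).+1 ->
  dist c e = refl i * dist d e.
Proof.
move=> cd l; apply: dist_step_up cd (has_length_len _) _.
by rewrite -l; exact: has_length_len.
Qed.

(** Along a reduced word every step goes up, where the distance is forced. *)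
Lemma dist_gallery u c d : len (refl_prod u) = size u ->
  gallery u c d -> dist c d = refl_prod u.
Proof.
elim: u c => [|i u ih] c red /=; first by move=> ->; rewrite refl_prod_nil distxx.
case=> c' cc' g; have redu := len_refl_prod_tail red.
have e := ih _ redu g; rewrite refl_prod_cons -e; apply: dist_up cc' _.
by rewrite e -refl_prod_cons red redu.
Qed.

Lemma residue_gallery J c d :
  residue J c d <-> exists2 u, {subset u <= J} & gallery u c d.
Proof.
split=> [[u uJ e]|[u]].
  by exists u => //; apply: gallery_dist.
elim: u c => [|i u ih] c uJ /= => [->|[c' cc' g]].
  by exists [::] => //; rewrite refl_prod_nil distxx.
have [|w wJ e] := ih c' _ g; first by move=> k ku; apply: uJ; rewrite inE ku orbT.
rewrite /residue /parabolic /=; case: (dist_step d cc') => ->; last by exists w.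
exists (i :: w); last by rewrite refl_prod_cons e.
by move=> k; rewrite inE => /predU1P[->|/wJ //]; apply: uJ; rewrite inE eqxx.
Qed.

Lemma residue_refl J c : residue J c c.
Proof. by apply/residue_gallery; exists [::]. Qed.

Lemma residue_sym J c d : residue J c d -> residue J d c.
Proof.
move=> /residue_gallery[u uJ g]; apply/residue_gallery.
by exists (rev u); [move=> k; rewrite mem_rev => /uJ | exact: gallery_rev].
Qed.

Lemma residue_trans J c d e : residue J c d -> residue J d e -> residue J c e.
Proof.
move=> /residue_gallery[u uJ g] /residue_gallery[v vJ h].
apply/residue_gallery; exists (u ++ v); last exact: gallery_cat g h.
by move=> k; rewrite mem_cat => /orP[/uJ|/vJ].
Qed.

Lemma residue_sub J J' c d : J \subset J' -> residue J c d -> residue J' c d.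
Proof. by move=> /fintype.subsetP s [u uJ e]; exists u => // k /uJ /s. Qed.

Lemma residue_eq J c d : residue J c = residue J d <-> residue J c d.
Proof.
split=> [->|cd]; first exact: residue_refl.
by apply/seteqP; split=> e; apply: residue_trans; first exact: residue_sym.
Qed.

Lemma residue_eqP J c d : residue J c d -> residue J c = residue J d.
Proof. by move/residue_eq. Qed.

Lemma residueT c d : residue [set: 'I_3]%SET c d.
Proof.
have [u e] := refl_prod_surj (dist c d).
by exists u => // k _; rewrite inE.
Qed.

Lemma adjP i c d : panel_of c i d <-> c = d \/ dist c d = refl i.
Proof.
split=> [|[->|cd]]; [|exact: residue_refl|]; last first.
  by exists [:: i]; [move=> k; rewrite !inE | rewrite refl_prod1].
case=> u ui e; suff: refl_prod u = 1 \/ refl_prod u = refl i.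
  by rewrite e => -[/dist_eq1|]; [left | right].
elim: u ui {e} => [|j u ih] ui; first by left; rewrite refl_prod_nil.
have : j \in [set i]%SET by apply: ui; rewrite inE eqxx.
rewrite inE refl_prod_cons => /eqP ->.
case: ih => [k ku|->|->]; first by apply: ui; rewrite inE ku orbT.
- by right; rewrite mulg1.
- by left; rewrite refl2.
Qed.

Lemma adj_dist i c d : dist c d = refl i -> panel_of c i d.
Proof. by move=> cd; apply/adjP; right. Qed.

Lemma adj_eq i j c d : i != j -> panel_of c i d -> panel_of c j d -> c = d.
Proof.
move=> ij /adjP[//|e] /adjP[//|]; rewrite e => /refl_inj /eqP.
by rewrite (negbTE ij).
Qed.

Lemma adj_vertex i a c d : i != a -> panel_of c i d -> vertex_of c a d.
Proof.
by move=> ia; apply: residue_sub; rewrite finset.sub1set !inE.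
Qed.

Lemma gallery_adj u c d (Q : X -> Prop) :
  (forall i x y, i \in u -> panel_of x i y -> Q x -> Q y) ->
  gallery u c d -> Q c -> Q d.
Proof.
elim: u c => [|i u ih] c H /=; first by move=> ->.
case=> c' cc' g Qc; apply: (ih c') => //.
  by move=> k x y ku; apply: H; rewrite inE ku orbT.
by apply: H (adj_dist cc') Qc; rewrite inE eqxx.
Qed.

Lemma residue_ind J c (Q : X -> Prop) :
  (forall i x y, i \in J -> panel_of x i y -> Q x -> Q y) -> Q c ->
  forall d, residue J c d -> Q d.
Proof.
move=> H Qc d /residue_gallery[u uJ g]; apply: gallery_adj g Qc.
by move=> i x y /uJ; exact: H.
Qed.

Lemma building_ind c (Q : X -> Prop) :
  (forall i x y, panel_of x i y -> Q x -> Q y) -> Q c -> forall d, Q d.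
Proof.
by move=> H Qc d; apply: residue_ind Qc _ (residueT c d) => i x y _; exact: H.
Qed.

(** The link of a vertex has diameter 3: any two of its chambers are joined by a
gallery of type i j i with repetitions allowed. *)
Lemma vertex_join i j a c d : i != j -> i != a -> j != a ->
  vertex_of c a d ->
  exists x y, [/\ panel_of c i x, panel_of x j y & panel_of y i d].
Proof.
move=> ij ia ja; rewrite /vertex_of (compl_set3 ij ia ja) => -[u uJ e].
have [v vs ev] := rank2_words ij uJ; move: e; rewrite -ev => /esym/gallery_dist g.
have rf := residue_refl; have s := adj_dist.
move: vs g; rewrite !inE; do ?[case/orP]; move=> /eqP -> /=.
- by move=> ->; exists d, d; split; exact: rf.
- by case=> x /s cx <-; exists x, x; split=> //; exact: rf.
- by case=> x /s cx <-; exists c, x; split=> //; exact: rf.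
- by case=> x /s cx [y /s xy <-]; exists x, y; split=> //; exact: rf.
- by case=> x /s cx [y /s xy <-]; exists c, x; split=> //; exact: rf.
- by case=> x /s cx [y /s xy [z /s yz <-]]; exists x, y; split.
Qed.

(** A circuit of four proper steps would be a gallery of type i j i, which is
reduced, between two j-adjacent chambers. *)
Lemma no_quadrangle i j (x x' y' y : X) : i != j ->
    panel_of x i x' -> panel_of x' j y' -> panel_of y' i y -> panel_of x j y ->
  [\/ x = x', x' = y' | y' = y].
Proof.
move=> ij /adjP[->|xx']; first by constructor 1.
move=> /adjP[->|x'y']; first by constructor 2.
move=> /adjP[->|y'y]; first by constructor 3.
have g : gallery [:: i; j; i] x y by exists x' => //; exists y' => //; exists y.
have red : len (refl_prod [:: i; j; i]) = 3%N.
  by rewrite !refl_prod_cons refl_prod_nil mulg1 len_refl3.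
have := dist_gallery red g; rewrite !refl_prod_cons refl_prod_nil mulg1 => e.
move=> /adjP[exy|]; last by rewrite e => /refl_conj_neq; case.
move: e; rewrite exy distxx => /(congr1 len); rewrite len1 len_refl3 //.
Qed.

(** A residue has a gate x, a chamber nearest to o, from which every other chamber of
the residue is reached by a gallery inside the residue that moves away from o at
each step. The gate is stated as an induction principle for properties
propagating along such galleries. The distance from x to o is of minimal length in
its coset, so lengths add up along reduced words of the parabolic subgroup. *)
Lemma residue_gate J c o : exists2 x, residue J c x &
  forall Q : X -> Prop, Q x ->
    (forall i y y', i \in J -> residue J c y -> residue J c y' -> Q y ->
       panel_of y i y' -> len (dist y' o) = (len (dist y o)).+1 -> Q y') ->
    forall y, residue J c y -> Q y.
Proof.
pose P n := `[< exists2 x, residue J c x & len (dist x o) = n >].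
have exP : exists n, P n.
  by exists (len (dist c o)); apply/asboolP; exists c => //; exact: residue_refl.
case: (ex_minnP exP) => n /asboolP[x cx <-] xmin.
exists x => // Q Qx Qstep.
(* The chambers of the residue realise the whole coset of the distance. *)
have coset u : {subset u <= J} -> (len (dist x o) <= len (refl_prod u * dist x o))%N.
  move=> uJ; suff [y cy <-] : exists2 y, residue J c y & dist y o = refl_prod u * dist x o.
    by apply: xmin; apply/asboolP; exists y.
  elim: u uJ => [|i u ih] uJ; first by exists x; rewrite // refl_prod_nil mul1g.
  have [|y cy e] := ih; first by move=> k ku; apply: uJ; rewrite inE ku orbT.
  have [y' yy' e'] := dist_exists y o i.
  exists y'; last by rewrite e' e refl_prod_cons mulgA.
  apply: residue_trans cy (residue_sub _ (adj_dist (dist_refl_sym yy'))).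
  by rewrite finset.sub1set; apply: uJ; rewrite inE eqxx.
have main u y : {subset u <= J} -> len (refl_prod u) = size u ->
    gallery u y x -> residue J c y /\ (Q y /\ dist y o = refl_prod u * dist x o).
  elim: u y => [|i u ih] y uJ red /=.
    by move=> ->; rewrite refl_prod_nil mul1g.
  have uJ' : {subset u <= J} by move=> k ku; apply: uJ; rewrite inE ku orbT.
  have red' := len_refl_prod_tail red.
  case=> y' yy' /(ih _ uJ' red')[cy' [Qy' e]].
  have iJ : i \in J by apply: uJ; rewrite inE eqxx.
  have l : len (refl i * dist y' o) = (len (dist y' o)).+1.
    rewrite e mulgA -refl_prod_cons (len_min_coset coset uJ red).
    by rewrite (len_min_coset coset uJ' red').
  have ey := dist_up yy' l.
  have cy : residue J c y.
    apply: residue_trans cy' (residue_sub _ (adj_dist (dist_refl_sym yy'))).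
    by rewrite finset.sub1set.
  split=> //; split; last by rewrite ey e refl_prod_cons mulgA.
  apply: (Qstep i y') => //; last by rewrite ey.
  exact/adj_dist/dist_refl_sym.
move=> y cy; have [u uJ e] : residue J y x by apply: residue_trans cx; exact: residue_sym.
have [u' [sub eu' red]] := reduced_subword u.
have [||_ []//] := main u' y _ red; first by move=> k /sub /uJ.
by apply: gallery_dist; rewrite eu' e.
Qed.

End Galleries.

(** * Simple connectedness of buildings *)

Section SimplyConnected.
Variables (X : building) (o : X) (G : groupType) (t : 'I_3 -> X -> X -> G).
Hypotheses
  (tM : forall a c d e, vertex_of c a d -> vertex_of c a e ->
     t a c d * t a d e = t a c e)
  (t_panel : forall i a b c d, i != a -> i != b -> panel_of c i d ->
     t a c d = t b c d).

(** The values obtained by multiplying the cocycle along minimal galleries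
issuing from o. *)
Inductive transport : X -> G -> Prop :=
| transport0 : transport o 1
| transportS c d i a g : i != a -> panel_of c i d ->
    len (dist d o) = (len (dist c o)).+1 ->
    transport c g -> transport d (g * t a c d).

Lemma cocycle_id a c : t a c c = 1.
Proof.
have h : vertex_of c a c by exact: residue_refl.
by apply: (mulgI (t a c c)); rewrite tM // mulg1.
Qed.

Lemma transport_ex c : exists g, transport c g.
Proof.
have [u su eu] := len_word (dist c o).
have red : len (refl_prod u) = size u by rewrite eu su.
have := gallery_dist (esym eu).
elim: u c red {su eu} => [|i u ih] c red /=.
  by move=> ->; exists 1; exact: transport0.
move=> g; have redu := len_refl_prod_tail red.
have ed := dist_gallery red g; case: g => c' cc' g'.
have [k tk] := ih c' redu g'; have [a ia _] := other_type i i.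
exists (k * t a c' c); apply: transportS tk => //.
  exact: ia.
  exact/residue_sym/adj_dist.
by rewrite ed red (dist_gallery redu g') redu.
Qed.

(** Inside a vertex the transport is the one from its gate: the galleries moving away
from o stay minimal when they are prolonged, and there the cocycle is a product. *)
Lemma transport_vertex a c : exists x k, [/\ vertex_of c a x, transport x k
  & forall y, vertex_of c a y -> transport y (k * t a x y)].
Proof.
have [x cx gate] := residue_gate (~: [set a])%SET c o.
have [k xk] := transport_ex x; exists x, k; split=> //.
apply: gate => [|i y y' + cy cy' yk yy' l]; first by rewrite cocycle_id mulg1.
rewrite !inE => ia; rewrite -(@tM a x y y') ?mulgA.
- exact: transportS ia yy' l yk.
- exact: residue_trans (residue_sym cx) cy.
- exact: residue_trans (residue_sym cx) cy'.
Qed.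

Lemma transportE d g : transport d g -> d = o /\ g = 1 \/
  exists c i a g', [/\ i != a, panel_of c i d, len (dist d o) = (len (dist c o)).+1,
    transport c g' & g = g' * t a c d].
Proof.
by case=> [|c d' i a g' ia cd l cg]; [left | right; exists c, i, a, g'].
Qed.

(** Induction on the distance to o. Two minimal galleries ending at c may end with
steps of types i and i'. With e a type different from both, the vertex of type e
of c contains both last steps, and both values equal the transport from its gate,
by induction applied to the chambers before c. *)
Lemma transport_uniq c g g' : transport c g -> transport c g' -> g = g'.
Proof.
have [n] := ubnP (len (dist c o)); elim: n => // n ih in c g g' *.
rewrite ltnS => ln.
move=> /transportE[[-> ->]|[b [i [a [h [ia bc lb bh ->]]]]]].
  move=> /transportE[[_ ->]//|[b [i [a [h [_ _]]]]]].
  by rewrite distxx len1.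
move=> /transportE[[co]|[b' [i' [a' [h' [ia' bc' lb' bh' ->]]]]]].
  by move: lb; rewrite co distxx len1.
have [e ie ie'] := other_type i i'; have [x [k [cx xk all]]] := transport_vertex e c.
have step y j f m : j != f -> j != e -> panel_of y j c -> transport y m ->
    len (dist c o) = (len (dist y o)).+1 -> m * t f y c = k * t e x c.
  move=> jf je yc ym l; have cy := residue_sym (adj_vertex je yc).
  rewrite (ih y m (k * t e x y)) ?(t_panel jf je yc) //; last exact: all.
    rewrite -mulgA tM //; first exact: residue_trans (residue_sym cx) cy.
    exact: residue_sym cx.
  by rewrite -l.
by rewrite (step b i a h) // (step b' i' a' h').
Qed.

(** A building is simply connected, in the strong sense that every closed gallery
decomposes into closed galleries inside vertices: a cocycle on pairs of chambers
sharing a vertex, well defined on panels, is a coboundary. *)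
Theorem trivial_cocycle : exists s : X -> G, s o = 1 /\
  forall a c d, vertex_of c a d -> s d = s c * t a c d.
Proof.
have /choice[s sP] := transport_ex; exists s; split.
  exact: transport_uniq (sP o) transport0.
move=> a c d cd; have [x [k [cx xk all]]] := transport_vertex a c.
rewrite (transport_uniq (sP d) (all d cd)).
rewrite (transport_uniq (sP c) (all c (residue_refl _ c))) -mulgA tM //.
  exact: residue_sym cx.
exact: residue_trans (residue_sym cx) cd.
Qed.

End SimplyConnected.

(** * Vertex links are projective planes *)

Section Links.
Variable X : building.
Implicit Types (c d x y z : X) (P Q u : set X).

(** The link of a vertex u of type a, for any numbering i, j of the two other types;
link is the case where i and j are cyclically after and before a. *)
Definition vertex_plane (i j : 'I_3) u : incidence_structure (set X) :=
  {| points := [set P | panels X i P /\ P `<=` u] ;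
     lines := [set P | panels X j P /\ P `<=` u] ;
     incident := fun P Q => P `&` Q !=set0 |}.

Lemma panels_vertexP i a c P : i != a ->
  (panels X i P /\ P `<=` vertex_of c a) <->
  exists2 d, vertex_of c a d & P = panel_of d i.
Proof.
move=> ia; split=> [[[d _ <-] sub]|[d cd ->]].
  by exists d => //; apply: sub; exact: residue_refl.
split; first by exists d.
by move=> e /(adj_vertex ia); exact: residue_trans.
Qed.

Lemma panel_eq i c d : panel_of c i = panel_of d i <-> panel_of c i d.
Proof. exact: residue_eq. Qed.

Lemma panel_sym i c d : panel_of c i d -> panel_of d i c.
Proof. exact: residue_sym. Qed.

Lemma panel_trans i c d e : panel_of c i d -> panel_of d i e -> panel_of c i e.
Proof. exact: residue_trans. Qed.

Lemma panel_refl i c : panel_of c i c.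
Proof. exact: residue_refl. Qed.

Lemma vertex_sym a c d : vertex_of c a d -> vertex_of d a c.
Proof. exact: residue_sym. Qed.

Lemma vertex_trans a c d e : vertex_of c a d -> vertex_of d a e -> vertex_of c a e.
Proof. exact: residue_trans. Qed.

Lemma panel_other i c : exists2 d, panel_of c i d & c <> d.
Proof.
have [d dc _] := dist_exists c c i; exists d.
  exact/panel_sym/adj_dist.
by move=> e; apply: (@refl_neq1 i); rewrite -dc e distxx.
Qed.

Lemma thick_two i c : thick X ->
  exists d e, [/\ panel_of c i d, panel_of c i e & [/\ c <> d, c <> e & d <> e]].
Proof.
move=> th; have [|x [y [z [[Px Py Pz] [xy xz yz]]]]] := th i (panel_of c i).
  by exists c.
have [cx|cx] := pselect (c = x); first by exists y, z; subst.
have [cy|cy] := pselect (c = y).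
  by exists x, z; subst; split=> //; split=> //; apply: nesym.
by exists x, y.
Qed.

Section Plane.
Variables i j a : 'I_3.
Hypotheses (ij : i != j) (ia : i != a) (ja : j != a).

Lemma panel_inj_incident c d : panel_of c j d -> panel_of c i = panel_of d i -> c = d.
Proof. by move=> cjd /panel_eq cid; exact: adj_eq ij cid cjd. Qed.

Lemma card_points_on_line v c : vertex_of v a c ->
  ([set P | (panels X i P /\ P `<=` vertex_of v a) /\ P `&` panel_of c j !=set0]
   #= panel_of c j)%card.
Proof.
move=> vc.
have -> : [set P | (panels X i P /\ P `<=` vertex_of v a) /\
                   P `&` panel_of c j !=set0] = (fun d => panel_of d i) @` panel_of c j.
  apply/seteqP; split=> [P [/(panels_vertexP _ _ ia)[d vd ->] [e [de ce]]]|P [d cd <-]].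
    by exists e => //; apply/panel_eq/panel_sym.
  split; last by exists d; split=> //; exact: panel_refl.
  apply/panels_vertexP => //; exists d => //; apply: vertex_trans vc _.
  exact: adj_vertex cd.
apply: inj_card_eq => d e; rewrite !inE => cd ce; apply: panel_inj_incident.
exact: panel_trans (panel_sym cd) ce.
Qed.

(** Two lines through two distinct points coincide, as there is no quadrangle. *)
Lemma line_unique x y x' y' : panel_of x j y -> panel_of x' j y' ->
  panel_of x i x' -> panel_of y i y' -> panel_of x i = panel_of y i \/
  panel_of x j x'.
Proof.
move=> xy xy' xx' yy'.
case: (no_quadrangle ij xx' xy' (panel_sym yy') xy) => [->|e|e].
- by right; exact: panel_refl.
- by left; apply/panel_eq; apply: panel_trans xx' _; rewrite e; exact: panel_sym.
- by right; apply: panel_trans xy _; rewrite -e; exact: panel_sym.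
Qed.

Lemma join_panels v c d : vertex_of v a c -> vertex_of v a d ->
    panel_of c i <> panel_of d i ->
  exists! Q, [/\ panels X j Q /\ Q `<=` vertex_of v a,
    panel_of c i `&` Q !=set0 & panel_of d i `&` Q !=set0].
Proof.
move=> vc vd cd.
have [|x [y [cx xy yd]]] := @vertex_join X i j a c d ij ia ja.
  exact: vertex_trans (vertex_sym vc) vd.
exists (panel_of x j); split.
  split; [|by exists x; split=> //; exact: panel_refl|].
    apply/panels_vertexP => //; exists x => //.
    exact: vertex_trans vc (adj_vertex ia cx).
  by exists y; split=> //; exact: panel_sym.
move=> Q [/(panels_vertexP _ _ ja)[z vz ->] [x' [cx' zx']] [y' [dy' zy']]].
apply/panel_eq; case: (@line_unique x y x' y') => //.
- exact: panel_trans (panel_sym zx') zy'.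
- exact: panel_trans (panel_sym cx) cx'.
- exact: panel_trans yd dy'.
- move=> e; case: cd; transitivity (panel_of x i); first exact/panel_eq.
  by rewrite e; apply/panel_eq.
- by move=> xx'; apply: panel_trans xx' _; exact: panel_sym.
Qed.

(** A perspectivity: a point y on the line of c is sent to the line joining it to
the point of d, which is possible because the point is off the line. *)
Lemma card_le_opposite c d : vertex_of c a d ->
  (forall x, panel_of c j x -> ~ panel_of d i x) ->
  (panel_of c j #<= panel_of d i)%card.
Proof.
move=> cd disj.
have /choice[f fP] : forall y, exists z, panel_of c j y ->
    panel_of d i z /\ exists2 x, panel_of y i x & panel_of x j z.
  move=> y; have [cy|?] := pselect (panel_of c j y); last by exists y.
  have [|x [z [yx xz zd]]] := @vertex_join X i j a y d ij ia ja.
    by apply: vertex_trans cd; apply: vertex_sym; exact: adj_vertex cy.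
  by exists z => _; split; [exact: panel_sym | exists x].
have sub : f @` panel_of c j `<=` panel_of d i.
  by move=> _ [y cy <-]; case: (fP y cy).
apply: card_le_trans (subset_card_le sub).
have /card_eqPle[] // : (f @` panel_of c j #= panel_of c j)%card.
apply: inj_card_eq => y y'; rewrite !inE => cy cy' ff.
have [dfy [x yx xz]] := fP y cy; have [_ [x' yx' xz']] := fP y' cy'.
have yy' : panel_of y j y' by apply: panel_trans (panel_sym cy) cy'.
have xx' : panel_of x j x'.
  by apply: panel_trans xz _; rewrite ff; exact: panel_sym.
case: (no_quadrangle ij yx xx' (panel_sym yx') yy') => [e|e|e].
- by case: (disj (f y)) => //; apply: panel_trans cy _; rewrite {1}e.
- by apply: (adj_eq ij _ yy'); apply: panel_trans yx _; rewrite e; exact: panel_sym.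
- case: (disj (f y)) => //; apply: panel_trans cy' _.
  by rewrite ff -{1}e.
Qed.

Lemma opposite_panel c : exists2 d, vertex_of c a d &
  forall x, panel_of c j x -> ~ panel_of d i x.
Proof.
have [c1 cc1 ne1] := panel_other i c; have [c2 cc2 ne2] := panel_other j c1.
exists c2 => [|x cx c2x].
  exact: vertex_trans (adj_vertex ia cc1) (adj_vertex ja cc2).
case: (no_quadrangle ij cc1 cc2 c2x cx) => // e; subst x.
apply: ne1; apply: adj_eq ij cc1 _.
by apply: panel_trans cx _; exact: panel_sym.
Qed.

(** The points of x1 and x2 lie on the line of x0, that of y1 lies on the line of y0,
and these lines meet only in the common point of x0 and y0. A line through all
three would be the line of x0, which does not contain the point of y1. *)
Lemma no_three_collinear x0 y0 x1 x2 y1 z :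
    panel_of x0 i y0 -> x0 <> y0 -> panel_of x0 j x1 -> panel_of x0 j x2 ->
    x1 <> x2 -> panel_of y0 j y1 -> y0 <> y1 ->
  ~ [/\ panel_of x1 i `&` panel_of z j !=set0, panel_of x2 i `&` panel_of z j !=set0
     & panel_of y1 i `&` panel_of z j !=set0].
Proof.
move=> x0y0 n0 x01 x02 n12 y01 ny [[z1 [xz1 zz1]] [z2 [xz2 zz2]] [z3 [yz3 zz3]]].
have x12 : panel_of x1 j x2 by apply: panel_trans (panel_sym x01) x02.
have z12 : panel_of z1 j z2 by apply: panel_trans (panel_sym zz1) zz2.
have xz : panel_of x1 j z1.
  case: (line_unique x12 z12 xz1 xz2) => // /(panel_inj_incident x12).
  by move/n12.
have x0z3 : panel_of x0 j z3.
  apply: panel_trans x01 (panel_trans xz _).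
  exact: panel_trans (panel_sym zz1) zz3.
have ji : j != i by rewrite eq_sym.
case: (no_quadrangle ji x0z3 (panel_sym yz3) (panel_sym y01) x0y0) => e.
- apply: ny; apply: (adj_eq ij _ y01); apply: panel_trans (panel_sym x0y0) _.
  by rewrite e; exact: panel_sym.
- apply: n0; apply: (adj_eq ij x0y0); apply: panel_trans x0z3 _.
  by rewrite e; exact: panel_sym.
- exact/ny/esym.
Qed.

End Plane.

Definition uniform_panels (q : nat) : Prop :=
  forall i c, (panel_of c i #= `I_q.+1)%card.

Lemma vertex_plane_projective i j a q u :
    thick X -> uniform_panels q -> i != j -> i != a -> j != a ->
  vertices X a u -> projective_plane (vertex_plane i j u) q.
Proof.
move=> th unif ij ia ja [v _ <-]; have ji : j != i by rewrite eq_sym.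
split.
- move=> P P' /(panels_vertexP _ _ ia)[c vc ->] /(panels_vertexP _ _ ia)[d vd ->].
  exact: join_panels.
- move=> P P' /(panels_vertexP _ _ ja)[c vc ->] /(panels_vertexP _ _ ja)[d vd ->].
  move=> /(join_panels ji ja ia vc vd)[Q [[Qv cQ dQ] Quniq]].
  exists Q; split=> [|Q' [Qv' cQ' dQ']]; first by split=> //; rewrite /= setIC.
  by apply: Quniq; split=> //; rewrite setIC.
(* Two points on each of two lines, away from the intersection of the lines. *)
- have [y0 xy0 n0] := panel_other i v.
  have [x1 [x2 [v1 v2 [nv1 nv2 n12]]]] := thick_two j v th.
  have [y1 [y2 [w1 w2 [nw1 nw2 m12]]]] := thick_two j y0 th.
  have vy : vertex_of v a y0 := adj_vertex ia xy0.
  have pt x : vertex_of v a x -> points (vertex_plane i j (vertex_of v a)) (panel_of x i).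
    by move=> vx; apply/panels_vertexP => //; exists x.
  exists (panel_of x1 i), (panel_of x2 i), (panel_of y1 i), (panel_of y2 i).
  split; split; try apply: pt.
  + exact: adj_vertex v1.
  + exact: adj_vertex v2.
  + exact: vertex_trans vy (adj_vertex ja w1).
  + exact: vertex_trans vy (adj_vertex ja w2).
  + case=> Q /(panels_vertexP _ _ ja)[z _ ->] [c1 c2 c3].
    by case: (no_three_collinear ij (z := z) xy0 n0 v1 v2 n12 w1 nw1).
  + case=> Q /(panels_vertexP _ _ ja)[z _ ->] [c1 c2 c3].
    by case: (no_three_collinear ij (z := z) xy0 n0 v1 v2 n12 w2 nw2).
  + case=> Q /(panels_vertexP _ _ ja)[z _ ->] [c1 c2 c3].
    by case: (no_three_collinear ij (z := z) (panel_sym xy0) (nesym n0) w1 w2 m12 v1 nv1).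
  + case=> Q /(panels_vertexP _ _ ja)[z _ ->] [c1 c2 c3].
    by case: (no_three_collinear ij (z := z) (panel_sym xy0) (nesym n0) w1 w2 m12 v2 nv2).
- move=> Q /(panels_vertexP _ _ ja)[c vc ->].
  exact: card_eq_trans (card_points_on_line ij ia ja vc) (unif j c).
Qed.

Lemma card_lines_through i j a q u P :
    uniform_panels q -> i != j -> i != a -> j != a ->
    vertices X a u -> points (vertex_plane i j u) P ->
  ([set Q | lines (vertex_plane i j u) Q /\ incident (vertex_plane i j u) P Q]
     #= `I_q.+1)%card.
Proof.
move=> unif ij ia ja [v _ <-] /(panels_vertexP _ _ ia)[c vc ->].
have ji : j != i by rewrite eq_sym.
have := card_eq_trans (card_points_on_line ji ja ia vc) (unif i c).
by congr (card_eq _ _); apply/seteqP; split=> Q /= []; rewrite setIC.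
Qed.

(** A point and a line off it in a common vertex link: perspectivities in both
directions. *)
Lemma panel_card_neq i j c : i != j -> exists d, (panel_of c j #= panel_of d i)%card.
Proof.
move=> ij; have [a ia ja] := other_type i j.
have [d cd disj] := opposite_panel ij ia ja c.
have ji : j != i by rewrite eq_sym.
exists d; apply: Cantor_Bernstein; first exact: card_le_opposite cd disj.
apply: (card_le_opposite ji ja ia (vertex_sym cd)).
by move=> x dx cx; exact: disj cx dx.
Qed.

End Links.

(** * Counting in finite projective planes *)

(** Finite classical sets are handled through injective enumerations by ordinals, so
that sums over finite types can count them. *)
Lemma card_enum (T : Type) (A : set T) n : (A #= `I_n)%card <->
  exists f : 'I_n -> T, injective f /\ forall x, A x <-> exists i, f i = x.
Proof.
split=> [/card_set_bijP[f [fA finj fsurj]]|[f [finj fA]]].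
  have /choice[g gP] : forall i : 'I_n, exists x, A x /\ f x = i.
    by move=> i; have [x Ax fx] := fsurj i (ltn_ord i); exists x.
  exists g; split=> [i j gij|x].
    by apply: val_inj; rewrite /= -(gP i).2 -(gP j).2 gij.
  split=> [Ax|[i <-]]; last by case: (gP i).
  exists (Ordinal (fA _ Ax)); apply: finj; rewrite ?inE //.
    by case: (gP (Ordinal (fA _ Ax))).
  by case: (gP (Ordinal (fA _ Ax))).
have -> : A = f @` [set: 'I_n].
  apply/seteqP; split=> x; first by move/fA => [i <-]; exists i.
  by case=> i _ <-; apply/fA; exists i.
have I_n : (val : 'I_n -> nat) @` [set: 'I_n] = `I_n.
  apply/seteqP; split=> [k [i _ <-]|k kn]; first exact: ltn_ord.
  by exists (Ordinal kn).
have e1 : (f @` [set: 'I_n] #= [set: 'I_n])%card by apply: inj_card_eq; exact: in2W.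
have e2 : ((val : 'I_n -> nat) @` [set: 'I_n] #= [set: 'I_n])%card.
  by apply: inj_card_eq; apply: in2W; exact: val_inj.
by rewrite -I_n; exact: card_eq_trans e1 (card_esym e2).
Qed.

Lemma finite_enum (T : Type) (A : set T) : finite_set A ->
  exists n (f : 'I_n -> T), injective f /\ forall x, A x <-> exists i, f i = x.
Proof. by case=> n /card_enum[f]; exists n, f. Qed.

Lemma card_enum_preim (T : Type) (A : set T) n k (f : 'I_n -> T) :
    injective f -> (forall x, A x -> exists i, f i = x) ->
  (A #= `I_k)%card -> #|[set i | `[< A (f i) >]]%SET| = k.
Proof.
move=> finj fA /card_enum[g [ginj gA]].
have /choice[h hP] : forall i, exists j, f j = g i.
  by move=> i; apply: fA; apply/gA; exists i.
have -> : [set i | `[< A (f i) >]]%SET = [set h i | i : 'I_k]%SET.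
  apply/setP => i; rewrite inE; apply/asboolP/imsetP => [/gA[j e]|[j _ ->]].
    by exists j => //; apply: finj; rewrite hP.
  by apply/gA; exists j; rewrite hP.
by rewrite card_imset ?card_ord // => i j e; apply: ginj; rewrite -!hP e.
Qed.

Section FinitePlane.
Variables (P L : finType) (inc : P -> L -> bool) (q : nat).
Hypothesis line_card : forall l, #|[set p | inc p l]%SET| = q.+1.
Hypothesis point_card : forall p, #|[set l | inc p l]%SET| = q.+1.

Lemma card_sum_inc (T : finType) (A : {set T}) (b : pred T) :
  #|[set x in A | b x]%SET| = (\sum_(x in A) b x)%N.
Proof.
rewrite -sum1_card; under eq_bigl do rewrite inE.
by rewrite big_mkcondr; apply: eq_bigr => x _; case: (b x).
Qed.

Lemma sum_incidences (O : {set L}) :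
  (\sum_p #|[set l in O | inc p l]%SET| = #|O| * q.+1)%N.
Proof.
under eq_bigr do rewrite card_sum_inc.
rewrite exchange_big /= -sum_nat_const; apply: eq_bigr => l _.
rewrite -(line_card l) -sum1_card; under [RHS]eq_bigl do rewrite inE.
by rewrite [RHS]big_mkcond; apply: eq_bigr => p _; case: (inc p l).
Qed.

Lemma card_points_lines : #|P| = #|L|.
Proof.
apply/eqP; rewrite -(eqn_pmul2r (ltn0Sn q)) -(cardsT L) -sum_incidences; apply/eqP.
rewrite -sum_nat_const; under [LHS]eq_bigl do rewrite inE.
apply: eq_bigr => p _; rewrite -(point_card p); apply: eq_card => l.
by rewrite !inE.
Qed.

Hypothesis join : forall p p', p != p' -> #|[set l | inc p l && inc p' l]%SET| = 1%N.

(** Every point other than p0 lies on exactly one of the q + 1 lines through p0. *)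
Lemma card_points (p0 : P) : #|P| = (q.+1 * q).+1.
Proof.
rewrite (cardD1 p0) inE add1n; congr _.+1.
have -> : #|[predD1 P & p0]| =
    (\sum_(p | p != p0) #|[set l in [set l | inc p0 l]%SET | inc p l]%SET|)%N.
  rewrite -sum1_card; apply: eq_big => [p|p]; rewrite !inE ?andbT // => pp0.
  rewrite eq_sym in pp0; rewrite -(join pp0); apply: eq_card => l.
  by rewrite !inE.
under eq_bigr do rewrite card_sum_inc.
rewrite exchange_big /= -(point_card p0) -sum_nat_const; apply: eq_bigr => l.
rewrite inE => p0l; apply: succn_inj; rewrite -(line_card l) (cardD1 p0) inE p0l add1n.
congr _.+1; rewrite -sum1_card big_mkcond [RHS]big_mkcond.
by apply: eq_bigr => p _; rewrite !inE; case: (p != p0); case: (inc p l).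
Qed.

(** Counting incident pairs in two ways gives (q^2 + q + 1) r = #|O| (q + 1); as
q^2 + q + 1 is prime to q + 1, it divides #|O|, which is at most q^2 + q + 1. *)
Lemma uniform_line_set (O : {set L}) (l0 : L) r : l0 \in O ->
  (forall p, #|[set l in O | inc p l]%SET| = r) -> O = [set: L]%SET.
Proof.
move=> l0O Or; have [p0 _] : exists p, p \in [set p | inc p l0]%SET.
  by apply/card_gt0P; rewrite line_card.
have := sum_incidences O; under eq_bigr do rewrite Or.
rewrite sum_nat_const => e.
have co : coprime #|P| q.+1.
  by rewrite (card_points p0) -addn1 mulnC coprime_sym /coprime gcdnMDl gcdn1.
have : #|P| %| #|O| by rewrite -(Gauss_dvdl _ co) -e dvdn_mulr.
move/dvdn_leq => le; apply/eqP; rewrite eqEcard finset.subsetT cardsT -card_points_lines.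
by apply: le; apply/card_gt0P; exists l0.
Qed.

End FinitePlane.

Section FiniteIncidence.
Variables (T : Type) (I : incidence_structure T) (q : nat).
Hypotheses (plane : projective_plane I q)
  (pencil : forall x, points I x ->
    ([set l | lines I l /\ incident I x l] #= `I_q.+1)%card)
  (fin_points : finite_set (points I)) (fin_lines : finite_set (lines I)).

Lemma enum_plane : exists n m (f : 'I_n -> T) (g : 'I_m -> T),
  [/\ injective f /\ (forall x, points I x <-> exists i, f i = x),
      injective g /\ (forall l, lines I l <-> exists i, g i = l)
    & let inc i j := `[< incident I (f i) (g j) >] in
      [/\ forall j, #|[set i | inc i j]%SET| = q.+1,
          forall i, #|[set j | inc i j]%SET| = q.+1
        & forall i i', i != i' -> #|[set j | inc i j && inc i' j]%SET| = 1%N]].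
Proof.
have [n [f [finj fP]]] := finite_enum fin_points.
have [m [g [ginj gP]]] := finite_enum fin_lines.
exists n, m, f, g; split=> //=; case: plane => join _ _ range; split=> [j|i|i i' ii'].
- have gj : lines I (g j) by apply/gP; exists j.
  rewrite -(card_enum_preim finj _ (range _ gj)) => [|x [/fP //]].
  apply: eq_card => i; rewrite !inE; apply/asboolP/asboolP => [h|[]//].
  by split=> //; apply/fP; exists i.
- have fi : points I (f i) by apply/fP; exists i.
  rewrite -(card_enum_preim ginj _ (pencil fi)) => [|x [/gP //]].
  apply: eq_card => j; rewrite !inE; apply/asboolP/asboolP => [h|[]//].
  by split=> //; apply/gP; exists j.
- have [||/finj e|l [[/gP[j <-] ij i'j] luniq]] := join (f i) (f i').
  + by apply/fP; exists i.
  + by apply/fP; exists i'.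
  + by rewrite e eqxx in ii'.
  apply/eqP/cards1P; exists j; apply/setP => k; rewrite !inE.
  apply/andP/eqP => [[/asboolP ik /asboolP i'k]|->]; last by split; apply/asboolP.
  by apply/esym/ginj/luniq; split=> //; apply/gP; exists k.
Qed.

(** A bijection exchanging A and its complement would make the number of points,
q (q + 1) + 1, even. *)
Lemma no_point_swap (A : set T) (t : T -> T) :
    (forall x, points I x -> points I (t x)) ->
    (forall x y, points I x -> points I y -> t x = t y -> x = y) ->
    (forall x, points I x -> A (t x) <-> ~ A x) -> False.
Proof.
move=> tP tinj tA.
have [n [m [f [g [[finj fP] [_ _] [lc pc jn]]]]]] := enum_plane.
have /choice[h hP] : forall i, exists j, f j = t (f i).
  by move=> i; apply/fP/tP/fP; exists i.
have fp i : points I (f i) by apply/fP; exists i.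
have hinj : injective h.
  by move=> i j e; apply/finj/tinj; rewrite // -!hP e.
pose B := [set i | `[< A (f i) >]]%SET.
have hB i : (h i \in B) = (i \notin B).
  rewrite !inE hP; apply/asboolP/idP => [/tA H|/asboolP H].
    by apply/asboolP; exact: H.
  exact/tA.
have le1 : (#|B| <= #|~: B|)%N.
  rewrite -(card_imset (mem B) hinj); apply/subset_leq_card.
  apply/fintype.subsetP => _ /imsetP[i iB ->].
  by rewrite inE hB negbK.
have le2 : (#|~: B| <= #|B|)%N.
  rewrite -(card_imset (mem (~: B)) hinj); apply/subset_leq_card.
  apply/fintype.subsetP => _ /imsetP[i iB ->].
  by rewrite hB; rewrite inE in iB.
have eB : #|B| = #|~: B| by apply/eqP; rewrite eqn_leq le1 le2.
case: plane => _ _ [x0 [_ [_ [_ [[/fP[p0 _] _ _ _] _]]]]] _.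
have := card_points lc pc jn p0; have := cardsC B; rewrite -eB => <-.
move/(congr1 odd); rewrite addnn odd_double /= oddM /= andNb.
by [].
Qed.

Variables (S : groupType) (act : S -> T -> T).
Hypotheses (actP : is_action act)
  (act_lines : forall s l, lines I l -> lines I (act s l))
  (act_inc : forall s x l, points I x -> lines I l ->
     (incident I (act s x) (act s l) <-> incident I x l))
  (act_reg : acts_regularly act (points I)).

Lemma act_inj s : injective (act s).
Proof.
case: actP => act1 actM x y e.
by rewrite -[x]act1 -[y]act1 -(mulVg s) !actM e.
Qed.

(** Every orbit of lines meets all points equally often, because the group is
transitive on points; hence it consists of all lines. The group is in bijection
with the points, so there are as many elements as lines, and a transitive action
is then free. *)
Lemma regular_on_lines : acts_regularly act (lines I).
Proof.
have [act1 actM] := actP; have [act_points trans free] := act_reg.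
have [n [m [f [g [[finj fP] [ginj gP] [lc pc jn]]]]]] := enum_plane.
have fp i : points I (f i) by apply/fP; exists i.
have gl j : lines I (g j) by apply/gP; exists j.
have /choice[phi phiP] : forall s, exists h : 'I_m -> 'I_m, forall j, g (h j) = act s (g j).
  move=> s; have /choice[h hP] : forall j, exists k, g k = act s (g j).
    by move=> j; exact/gP/act_lines.
  by exists h.
have orbitT l0 : forall l, exists s, act s (g l0) = g l.
  pose O := [set l | `[< exists s, act s (g l0) = g l >]]%SET.
  pose Op i := [set j in O | `[< incident I (f i) (g j) >]]%SET.
  have le i i' : (#|Op i| <= #|Op i'|)%N.
    have [s fii'] := trans _ _ (fp i) (fp i').
    have pinj : injective (phi s).
      by move=> j k e; apply/ginj/(@act_inj s); rewrite -!phiP e.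
    rewrite -(card_imset (mem (Op i)) pinj).
    apply/subset_leq_card/fintype.subsetP => _ /imsetP[j + ->].
    rewrite !inE => /andP[/asboolP[s' e] /asboolP ij]; apply/andP; split; apply/asboolP.
      by exists (s * s'); rewrite actM e phiP.
    by rewrite phiP -fii'; apply/act_inc.
  have l0O : l0 \in O by rewrite inE; apply/asboolP; exists 1.
  have [i0 _] : exists p, p \in [set p | `[<incident I (f p) (g l0)>]]%SET.
    by apply/card_gt0P; rewrite lc.
  have := uniform_line_set lc pc jn l0O (r := #|Op i0|).
  move=> OT l; have : l \in O.
    by rewrite OT ?inE // => i; apply/eqP; rewrite eqn_leq !le.
  by rewrite inE => /asboolP.
split=> [//|_ _ /gP[l <-] /gP[l' <-]|s _ /gP[l0 <-] sl0]; first exact: orbitT.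
have [p0 _] : exists p, p \in [set p | `[<incident I (f p) (g l0)>]]%SET.
  by apply/card_gt0P; rewrite lc.
have /choice[sg sgP] : forall p, exists s, act s (f p0) = f p.
  by move=> p; exact: trans.
have act_free s1 s2 p : act s1 (f p) = act s2 (f p) -> s1 = s2.
  move=> e; apply: (mulgI s2^-1); rewrite mulVg; apply: (free _ (f p)) => //.
  by rewrite actM e -actM mulVg act1.
(* Points stand for group elements, and psi is the orbit map of the line l0. *)
pose psi p := phi (sg p) l0.
have /choice[chi chiP] : forall l, exists p, psi p = l.
  move=> l; have [s' e] := orbitT l0 l; have /fP[p fpe] := act_points s' _ (fp p0).
  exists p; apply: ginj; rewrite phiP -e; congr (act _ _).
  by apply: (act_free _ _ p0); rewrite sgP.
have chi_inj : injective chi by move=> l l' e; rewrite -[l]chiP -[l']chiP e.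
have [chi' chiK chiK'] : bijective chi.
  apply: inj_card_bij chi_inj _; exact: eq_leq (card_points_lines lc pc).
have /fP[p1 e1] := act_points s _ (fp p0).
have s1 : sg p1 = s by apply: (act_free _ _ p0); rewrite sgP.
have s0 : sg p0 = 1 by apply: (act_free _ _ p0); rewrite sgP act1.
have psi01 : psi p0 = psi p1 by apply: ginj; rewrite !phiP s0 s1 act1 sl0.
have p01 : p0 = p1.
  by rewrite -(chiK' p0) -(chiK' p1) -(chiP (chi' p0)) -(chiP (chi' p1)) !chiK' psi01.
by apply: (free _ (f p0)) => //; rewrite -e1 p01.
Qed.

End FiniteIncidence.

(** * The action of automorphisms on types *)

Section TypePerm.
Variable X : building.
Implicit Types (g h : aut X) (c d : X).

Definition induces g (s : 'S_3) : Prop :=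
  forall i c d, panel_of c i d <-> panel_of (g c) (s i) (g d).

Definition type_perm g : 'S_3 := projT1 (cid (aut_types g)).

Lemma type_permP g : induces g (type_perm g).
Proof. exact: (projT2 (cid (aut_types g))). Qed.

Lemma panel_type i j c : panel_of c i = panel_of c j -> i = j.
Proof.
move=> e; apply/eqP/negPn/negP => ij; have [d cd ne] := panel_other i c.
apply: ne; apply: (adj_eq ij cd); by rewrite -e.
Qed.

Lemma aut_panel g s c i : induces g s ->
  aut_act g (panel_of c i) = panel_of (g c) (s i).
Proof.
move=> gs; apply/seteqP; split=> [_ [d cd <-]|d cd]; first exact: (gs i c d).1 cd.
exists (aut_inv g d); last exact: aut_invK.
by apply: (gs _ _ _).2; rewrite aut_invK.
Qed.

Lemma induces_uniq g s s' : induces g s -> induces g s' -> s = s'.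
Proof.
move=> gs gs'; case: (chamber_inhabited X) => c; apply/permP => i.
by apply: (@panel_type _ _ (g c)); rewrite -!aut_panel.
Qed.

Lemma aut_actP g i c :
  aut_act g (panel_of c i) = panel_of (g c) (type_perm g i).
Proof. exact/aut_panel/type_permP. Qed.

Lemma autM g h c : (g * h) c = g (h c).
Proof. by []. Qed.

Lemma type_permM g h : type_perm (g * h) = type_perm h * type_perm g.
Proof.
apply: (induces_uniq (@type_permP _)) => i c d.
by rewrite permM !autM -(type_permP g) -(type_permP h).
Qed.

Lemma type_perm1 : type_perm 1 = 1.
Proof. by apply: (induces_uniq (@type_permP _)) => i c d; rewrite perm1. Qed.

Lemma type_permV g : type_perm g^-1 = (type_perm g)^-1.
Proof.
by apply: (mulIg (type_perm g)); rewrite -type_permM mulgV type_perm1 mulVg.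
Qed.

Lemma aut_vertex g a c :
  aut_act g (vertex_of c a) = vertex_of (g c) (type_perm g a).
Proof.
apply/seteqP; split=> [_ [d cd <-]|d cd].
  apply: (residue_ind (Q := fun d => vertex_of (g c) (type_perm g a) (g d)) _ _ cd).
    move=> i x y ia xy cx.
    apply: vertex_trans cx (adj_vertex _ ((type_permP g _ _ _).1 xy)).
    by rewrite (inj_eq perm_inj); rewrite !inE in ia.
  exact: residue_refl.
exists (aut_inv g d); last exact: aut_invK.
apply: (residue_ind (Q := fun d => vertex_of c a (aut_inv g d)) _ _ cd).
  move=> i x y; rewrite !inE => ia xy cx.
  apply: vertex_trans cx (adj_vertex (i := (type_perm g)^-1 i) _ _).
    by apply: contraNneq ia => <-; rewrite permKV.
  by apply: (type_permP g _ _ _).2; rewrite permKV !aut_invK.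
by rewrite aut_funK; exact: residue_refl.
Qed.

Lemma aut_act_sub g (A B : set X) : A `<=` B -> aut_act g A `<=` aut_act g B.
Proof. exact: image_subset. Qed.

Lemma aut_actK g (A : set X) : aut_act g^-1 (aut_act g A) = A.
Proof. by rewrite -aut_actM mulVg aut_act1. Qed.

End TypePerm.

(** * Panel-regular groups preserve types *)

Section Regular.
Variables (X : building) (Gamma : groupClosed (aut X)).

Lemma panel_regularP i : panel_regular Gamma i <->
  [/\ forall g P, g \in Gamma -> panels X i P -> panels X i (aut_act g P),
      forall P Q, panels X i P -> panels X i Q -> exists2 g, g \in Gamma & aut_act g P = Q
    & forall g P, g \in Gamma -> panels X i P -> aut_act g P = P -> g = 1].
Proof.
split=> [[pres trans free]|[pres trans free]].
  split=> [g P Gg|P Q iP iQ|g P Gg iP e].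
  - exact: (pres (Sub g Gg : subgrp Gamma)).
  - by have [g e] := trans P Q iP iQ; exists (val g); first exact: (valP g).
  - have := free (Sub g Gg : subgrp Gamma) P iP e.
    by move/(congr1 val).
split=> [g P|P Q iP iQ|g P iP e].
- exact/pres/(valP g).
- by have [g Gg e] := trans P Q iP iQ; exists (Sub g Gg : subgrp Gamma).
- by apply: val_inj; apply: free (valP g) iP e.
Qed.

Lemma stabP v g : reflect (g \in Gamma /\ aut_act g v = v) (g \in stab Gamma v).
Proof.
apply: (iffP idP) => [/andP[Gg /asboolP gv] //|[Gg gv]].
by apply/andP; split=> //; apply/asboolP.
Qed.

Section RegularOnType.
Variables (i : 'I_3).
Hypothesis reg : panel_regular Gamma i.

Lemma type_perm_fix g : g \in Gamma -> type_perm g i = i.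
Proof.
case/panel_regularP: reg => pres _ _ Gg; case: (chamber_inhabited X) => c.
have [|d _ e] := pres g (panel_of c i) Gg; first by exists c.
rewrite aut_actP in e; apply: (@panel_type X _ _ (g c)); rewrite -e.
by apply/panel_eq; rewrite e; exact: panel_refl.
Qed.

Lemma panels_equipotent (c d : X) : (panel_of c i #= panel_of d i)%card.
Proof.
case/panel_regularP: reg => _ trans _.
have [||g _ <-] := trans (panel_of c i) (panel_of d i); [by exists c|by exists d|].
have ginj : injective g by exact: can_inj (@aut_funK _ g).
by apply/card_esym/inj_card_eq; exact: in2W.
Qed.

Lemma uniform_of_regular : locally_finite X -> exists q, uniform_panels X q.
Proof.
move=> lf; case: (chamber_inhabited X) => c.
have [a ia _] := other_type i i.
have [n cn] : finite_set (panel_of c i).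
  apply: sub_finite_set (lf a (vertex_of c a) _); last by exists c.
  by move=> d; exact: adj_vertex.
case: n cn => [|q] cq.
  move: cq; rewrite II0 card_eq0 => /eqP e.
  by have : panel_of c i c by [exact: panel_refl]; rewrite e.
exists q => j d; have [->|ij] := eqVneq j i.
  exact: card_eq_trans (panels_equipotent _ _) cq.
rewrite eq_sym in ij; have [e de] := panel_card_neq d ij.
exact: card_eq_trans de (card_eq_trans (panels_equipotent _ _) cq).
Qed.

End RegularOnType.

Section TypePreserving.
Variable i : 'I_3.
Hypotheses (reg : panel_regular Gamma i) (th : thick X) (lf : locally_finite X).

Lemma finite_panels_vertex j a (v : X) : j != a ->
  finite_set [set P | panels X j P /\ P `<=` vertex_of v a].
Proof.
move=> ja; have fv : finite_set (vertex_of v a) by apply: (lf (a := a)); exists v.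
apply: sub_finite_set (finite_image (fun d => panel_of d j) fv).
by move=> P /(panels_vertexP _ _ ja)[d vd ->]; exists d.
Qed.

(** Both g and h carry the same vertex of c to the vertex of v of type a. *)
Lemma same_type_fix (g h : aut X) a v c : type_perm g = type_perm h ->
  vertex_of v a (g c) -> vertex_of v a (h c) ->
  aut_act (g * h^-1) (vertex_of v a) = vertex_of v a.
Proof.
move=> gh vg vh; have e (f : aut X) : vertex_of v a (f c) ->
    vertex_of v a = aut_act f (vertex_of c ((type_perm f)^-1 a)).
  by move=> /residue_eqP; rewrite aut_vertex permKV.
by rewrite {1}(e h vh) aut_actM aut_actK -gh -(e g vg).
Qed.

(** An element of Gamma fixes the type i, so if it moves types it exchanges the two
others. Label each panel of type i by the unique element of Gamma carrying a base
panel to it. If both kinds of labels, type preserving or not, occurred, then by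
connectedness they would occur at two panels x, y of type i sharing a vertex.
Right multiplication of the labels by h^-1 h' or its inverse, where h and h' label x and
y, then exchanges the two kinds among the panels at this vertex, which are the
points of a projective plane: their number would be even. *)
Lemma type_preserving g : g \in Gamma -> type_perm g = 1.
Proof.
have [pres trans free] := (panel_regularP i).1 reg.
case: (chamber_inhabited X) => c0; pose e0 := panel_of c0 i.
have e0i : panels X i e0 by exists c0.
have free' g1 g2 : g1 \in Gamma -> g2 \in Gamma -> aut_act g1 e0 = aut_act g2 e0 -> g1 = g2.
  move=> G1 G2 e; apply: (mulgI g2^-1); rewrite mulVg; apply: (free _ e0) => //.
    by rewrite gpredM ?gpredV.
  by rewrite aut_actM e aut_actK.
have [q unif] := uniform_of_regular reg lf.
suff H : forall c, exists h,
    [/\ h \in Gamma, type_perm h = 1 & aut_act h e0 = panel_of c i].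
  move=> Gg; have [h [Gh h1 e]] := H (g c0).
  by rewrite (free' g h) // e /e0 aut_actP (type_perm_fix reg).
apply: building_ind => [m x y xy|]; last first.
  by exists 1; rewrite gpred1 type_perm1 aut_act1.
move=> [h [Gh h1 hx]]; have [im|im] := eqVneq i m.
  by exists h; split=> //; rewrite hx; apply/panel_eq; rewrite im.
have [a ia ma] := other_type i m.
have [|h' Gh' hy] := trans e0 (panel_of y i) e0i; first by exists y.
exists h'; split=> //; apply/eqP/negPn/negP => h'1.
have xv := adj_vertex ma xy.
have plane := vertex_plane_projective th unif im ia ma (ex_intro2 _ _ x I erefl).
have hc0 : vertex_of x a (h c0).
  apply: (adj_vertex ia); rewrite -hx; exists c0 => //; exact: panel_refl.
have hc0' : vertex_of x a (h' c0).
  apply: vertex_trans xv (adj_vertex ia _); rewrite -hy; exists c0 => //; exact: panel_refl.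
have vi : type_perm h' i = i by exact: type_perm_fix.
have /choice[gm gmP] : forall P, exists g, panels X i P -> g \in Gamma /\ aut_act g e0 = P.
  move=> P; have [iP|?] := pselect (panels X i P); last by exists 1.
  by have [f Gf e] := trans e0 P e0i iP; exists f.
pose A P := type_perm (gm P) = 1.
pose k P := if `[< A P >] then h^-1 * h' else h'^-1 * h.
have Gk P : k P \in Gamma by rewrite /k; case: ifP => _; rewrite gpredM ?gpredV.
pose t P := aut_act (gm P * k P) e0.
have tP P : panels X i P -> panels X i (t P) /\ gm (t P) = gm P * k P.
  move=> iP; have [GP eP] := gmP P iP.
  have it : panels X i (t P) by apply: pres => //; rewrite gpredM.
  by split=> //; apply: free'; rewrite ?gpredM //; case: (gmP _ it).
have tA P : panels X i P -> A (t P) <-> ~ A P.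
  move=> iP; have [_ e] := tP P iP; have [GP eP] := gmP P iP.
  rewrite /A e type_permM /k; case: asboolP => AP.
    rewrite type_permM type_permV AP h1 invg1 mulg1 mulg1.
    by split=> // /eqP; rewrite (negbTE h'1).
  split=> // _; rewrite type_permM type_permV h1 mul1g.
  rewrite (fix_perm_eq (type_perm_fix reg GP) vi) ?mulVg //; exact/eqP.
apply: (no_point_swap plane _ _ _ (A := A) (t := t)).
- by move=> P; apply: card_lines_through unif im ia ma (ex_intro2 _ _ x I erefl).
- exact: finite_panels_vertex.
- exact: finite_panels_vertex.
- move=> P [iP Pv]; split; first by case: (tP P iP).
  have [GP eP] := gmP P iP.
  have gc0 : vertex_of x a (gm P c0).
    have : aut_act (gm P) e0 (gm P c0) by exists c0 => //; exact: panel_refl.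
    by rewrite eP => /Pv.
  rewrite /t /k; case: asboolP => AP.
    rewrite mulgA aut_actM hy -(same_type_fix _ gc0 hc0); last by rewrite h1.
    by apply: aut_act_sub => d yd; apply: vertex_trans xv (adj_vertex ia yd).
  rewrite mulgA aut_actM hx -(same_type_fix _ gc0 hc0').
    by apply: aut_act_sub => d; exact: adj_vertex.
  by apply: (fix_perm_eq (type_perm_fix reg GP) vi) => //; exact/eqP.
- move=> P Q [iP _] [iQ _] e; have [GP eP] := gmP P iP; have [GQ eQ] := gmP Q iQ.
  have AA : `[< A P >] = `[< A Q >].
    apply/asboolP/asboolP => H; apply: contrapT.
      by move=> /(tA Q iQ).2; rewrite -e => /(tA P iP).1.
    by move=> /(tA P iP).2; rewrite e => /(tA Q iQ).1.
  rewrite -eP -eQ; congr (aut_act _ e0); apply: (mulIg (k P)).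
  have [_ <-] := tP P iP; rewrite e; have [_ ->] := tP Q iQ.
  by rewrite /k AA.
- by move=> P [iP _]; exact: tA.
Qed.

End TypePreserving.

End Regular.

(** * Vertex stabilisers are Singer groups *)

Section Singer.
Variables (X : building) (Gamma : groupClosed (aut X)).
Hypotheses (th : thick X) (lf : locally_finite X)
  (typed : forall g, g \in Gamma -> type_perm g = 1).

Lemma typed_panel g c i : g \in Gamma -> aut_act g (panel_of c i) = panel_of (g c) i.
Proof. by move=> Gg; rewrite aut_actP typed // perm1. Qed.

Lemma typed_vertex g c a : g \in Gamma -> aut_act g (vertex_of c a) = vertex_of (g c) a.
Proof. by move=> Gg; rewrite aut_vertex typed // perm1. Qed.

Lemma typed_panels g i P : g \in Gamma -> panels X i P -> panels X i (aut_act g P).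
Proof. by move=> Gg [c _ <-]; exists (g c) => //; rewrite typed_panel. Qed.

Lemma aut_act_incident (g : aut X) (P Q : set X) :
  aut_act g P `&` aut_act g Q !=set0 <-> P `&` Q !=set0.
Proof.
split=> [[_ [[c Pc <-] [d Qd /(can_inj (@aut_funK _ g)) e]]]|[c [Pc Qc]]].
  by exists c; split=> //; rewrite -e.
by exists (g c); split; exists c.
Qed.

Lemma stab_act_action u : is_action (@stab_act X Gamma u).
Proof.
by split=> [P|g h P]; rewrite /stab_act; [exact: aut_act1 | exact: aut_actM].
Qed.

Lemma stab_act_panels u (s : subgrp (stab Gamma u)) i P :
  panels X i P /\ P `<=` u -> panels X i (stab_act s P) /\ stab_act s P `<=` u.
Proof.
case: s => s su [iP Pu]; have [Gs es] := stabP _ _ _ su; split; first exact: typed_panels.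
by rewrite -[X in _ `<=` X]es; exact: aut_act_sub.
Qed.

(** An element carrying a panel of the vertex u to another one preserves types, so it
fixes u. *)
Lemma stab_regular i a u : panel_regular Gamma i -> i != a -> vertices X a u ->
  acts_regularly (@stab_act X Gamma u) [set P | panels X i P /\ P `<=` u].
Proof.
move=> /panel_regularP[_ trans free] ia [v _ <-]; split.
- by move=> s P; exact: stab_act_panels.
- move=> P Q [iP Pv] [iQ Qv]; have [g Gg e] := trans P Q iP iQ.
  have gs : g \in stab Gamma (vertex_of v a).
    apply/stabP; split=> //; case: iP Pv e => c _ <- Pv e.
    have vc : vertex_of v a c by apply: Pv; exact: panel_refl.
    have vE : vertex_of v a = vertex_of c a := residue_eqP vc.
    rewrite vE typed_vertex //; symmetry; apply/residue_eq.
    apply: vertex_trans (vertex_sym vc) _; apply: Qv; rewrite -e.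
    by exists c => //; exact: panel_refl.
  by exists (Sub g gs : subgrp (stab Gamma (vertex_of v a))).
- move=> s P [iP _] e; apply: val_inj; apply: free iP e.
  by case/stabP: (valP s).
Qed.

Lemma stab_singer i j a u : panel_regular Gamma i -> i != a -> vertices X a u ->
  singer_group (vertex_plane i j u) (@stab_act X Gamma u).
Proof.
move=> reg ia au; split.
- exact: stab_act_action.
- by move=> s l; exact: stab_act_panels.
- by move=> s P Q _ _; exact: aut_act_incident.
- exact: stab_regular reg ia au.
Qed.

(** In the link of a vertex whose type is neither i nor j, the stabiliser is regular
on points, hence on lines; and Gamma is transitive on the vertices of this
type. *)
Lemma regular_other i j : panel_regular Gamma i -> panel_regular Gamma j.
Proof.
move=> reg; have [<-//|ij] := eqVneq i j.
have [a ia ja] := other_type i j; have [q unif] := uniform_of_regular reg lf.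
have reg_lines u : vertices X a u ->
    acts_regularly (@stab_act X Gamma u) [set P | panels X j P /\ P `<=` u].
  move=> au; have [act lact incact preg] := stab_singer j reg ia au.
  have plane := vertex_plane_projective th unif ij ia ja au.
  apply: (regular_on_lines plane _ _ _ act lact incact preg).
  - by move=> P; exact: card_lines_through unif ij ia ja au.
  - by case: au => v _ <-; exact: finite_panels_vertex.
  - by case: au => v _ <-; exact: finite_panels_vertex.
have [_ trans _] := (panel_regularP _ _).1 reg.
have sub c : panel_of c j `<=` vertex_of c a by move=> d; exact: adj_vertex.
apply/panel_regularP; split=> [g P|_ _ [c _ <-] [d _ <-]|g _ Gg [c _ <-] e].
- exact: typed_panels.
- have [||g Gg e] := trans (panel_of c i) (panel_of d i); [by exists c|by exists d|].
  have ed : aut_act g (vertex_of c a) = vertex_of d a.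
    rewrite typed_vertex //; symmetry; apply/residue_eq; apply: (adj_vertex ia).
    by apply/panel_eq; rewrite -e typed_panel.
  have [_ tr _] := reg_lines (vertex_of d a) (ex_intro2 _ _ d I erefl).
  have [||s es] := tr (aut_act g (panel_of c j)) (panel_of d j).
  + by split; [apply: typed_panels => //; exists c | rewrite -ed; exact/aut_act_sub/sub].
  + by split; [exists d | exact: sub].
  exists (val s * g); last by rewrite aut_actM.
  by rewrite gpredM //; case/stabP: (valP s).
- have gs : g \in stab Gamma (vertex_of c a).
    apply/stabP; split=> //; rewrite typed_vertex //; symmetry; apply/residue_eq.
    by apply: sub; rewrite -e; exists c => //; exact: panel_refl.
  have [_ _ fr] := reg_lines (vertex_of c a) (ex_intro2 _ _ c I erefl).
  have : (Sub g gs : subgrp (stab Gamma (vertex_of c a))) = 1.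
    by apply: (fr _ (panel_of c j)) => //; split; [exists c | exact: sub].
  by move/(congr1 val).
Qed.

End Singer.

Lemma subgrp_valM (G : groupType) (H : groupClosed G) (x y : subgrp H) :
  val (x * y) = val x * val y.
Proof. exact: valM. Qed.

(** * Panel coordinates and difference sets *)

Section PanelCoordinates.
Variables (X : building) (Gamma : groupClosed (aut X)) (o : X).
Hypotheses (typed : forall g, g \in Gamma -> type_perm g = 1)
  (free : forall g i, g \in Gamma -> aut_act g (panel_of o i) = panel_of o i -> g = 1).
(** By regularity the panel of type i of a chamber c is the translate of the one of
o by a unique element of Gamma, gam i c. The three elements gam 0 c, gam 1 c and
gam 2 c are the coordinates of c. *)
Variable gam : 'I_3 -> X -> aut X.
Hypotheses (gamG : forall i c, gam i c \in Gamma)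
  (gamP : forall i c, aut_act (gam i c) (panel_of o i) = panel_of c i).

Let Gtyped_panel := typed_panel typed.
Let Gtyped_vertex := typed_vertex typed.

Lemma GammaM g h : g \in Gamma -> h \in Gamma -> g * h \in Gamma.
Proof. by move=> Gg Gh; rewrite gpredM. Qed.

Lemma GammaV g : g \in Gamma -> g^-1 \in Gamma.
Proof. by move=> Gg; rewrite gpredV. Qed.

Lemma gam_eq g i c : g \in Gamma -> aut_act g (panel_of o i) = panel_of c i -> gam i c = g.
Proof.
move=> Gg e; apply: (mulgI g^-1); rewrite mulVg; apply: (free (i := i)).
  by apply: GammaM => //; exact: GammaV.
by rewrite aut_actM gamP -e aut_actK.
Qed.

Lemma gam_act g i c : g \in Gamma -> gam i (g c) = g * gam i c.
Proof.
move=> Gg; apply: gam_eq; first exact: GammaM.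
by rewrite aut_actM gamP Gtyped_panel.
Qed.

Lemma gam_panel i c d : panel_of c i d <-> gam i c = gam i d.
Proof.
split=> [/panel_eq cd|e]; first by apply: gam_eq; rewrite // gamP cd.
by apply/panel_eq; rewrite -(gamP i c) e gamP.
Qed.

Lemma gam_base i : gam i o = 1.
Proof. by apply: gam_eq; rewrite ?gpred1 ?aut_act1. Qed.

Lemma gam_orbit g i : g \in Gamma -> gam i (g o) = g.
Proof. by move=> Gg; rewrite gam_act // gam_base mulg1. Qed.

Lemma gam_vertex i a c : i != a -> aut_act (gam i c) (vertex_of o a) = vertex_of c a.
Proof.
move=> ia; rewrite Gtyped_vertex //; apply/residue_eq/(adj_vertex ia)/panel_eq.
by rewrite -(gamP i c) Gtyped_panel.
Qed.

Lemma gam_stab i j a c d : i != a -> j != a -> vertex_of c a d ->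
  (gam i c)^-1 * gam j d \in stab Gamma (vertex_of o a).
Proof.
move=> ia ja cd; apply/stabP; split.
  by apply: GammaM => //; exact: GammaV.
have e : vertex_of c a = vertex_of d a := residue_eqP cd.
by rewrite aut_actM (gam_vertex d ja) -e -(gam_vertex c ia) aut_actK.
Qed.

(** The panels of c through its vertex of type a are gam (a + 1) c and gam (a - 1) c
translates of those of o, so this element stabilises the vertex of type a of o.
It is an element of the difference set at this vertex, and the product of the
three turns of a chamber telescopes to 1. *)
Definition turn (a : 'I_3) (c : X) : aut X := (gam (ordS a) c)^-1 * gam (ord_pred a) c.

Lemma turn_act g a c : g \in Gamma -> turn a (g c) = turn a c.
Proof. by move=> Gg; rewrite /turn !gam_act // invgM -mulgA mulKg. Qed.

Lemma turn_stab a c : turn a c \in stab Gamma (vertex_of o a).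
Proof.
apply: gam_stab; [exact: ordS_neq | exact: ord_pred_neq | exact: residue_refl].
Qed.

Lemma turn_base a : turn a o = 1.
Proof. by rewrite /turn !gam_base invg1 mulg1. Qed.

Lemma turn_prod c :
  turn ord0 c * (turn (ordS ord0) c * turn (ord_pred ord0) c) = 1.
Proof.
rewrite /turn.
have -> : ordS (ordS ord0) = ord_pred ord0 :> 'I_3 by exact: val_inj.
have -> : ordS (ord_pred ord0) = ord0 :> 'I_3 by exact: val_inj.
have -> : ord_pred (ordS ord0) = ord0 :> 'I_3 by exact: val_inj.
have -> : ord_pred (ord_pred ord0) = ordS ord0 :> 'I_3 by exact: val_inj.
by rewrite -!mulgA !mulVKg mulVg.
Qed.

(** An element s of the difference set is witnessed by a chamber lying on the panel of
type a + 1 of o and on the s-translate of the panel of type a - 1. Translating it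
into the panel of type 0 of o does not change its turns. *)
Lemma turn_difference a s : s \in stab Gamma (vertex_of o a) ->
  panel_of o (ordS a) `&` aut_act s (panel_of o (ord_pred a)) !=set0 <->
  exists2 c, panel_of o ord0 c & turn a c = s.
Proof.
move=> /stabP[Gs _]; split=> [[c [oc]]|[c oc <-]].
  rewrite Gtyped_panel // => sc.
  exists ((gam ord0 c)^-1 c).
    by apply/gam_panel; rewrite gam_base gam_act ?mulVg //; exact: GammaV.
  rewrite turn_act; last exact: GammaV.
  rewrite /turn -((gam_panel _ _ _).1 oc) gam_base invg1 mul1g.
  by rewrite -((gam_panel _ _ _).1 sc) gam_orbit.
exists ((gam (ordS a) c)^-1 c); split.
  by apply/gam_panel; rewrite gam_base gam_act ?mulVg //; exact: GammaV.
rewrite /turn aut_actM gamP Gtyped_panel; last exact: GammaV.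
exact: panel_refl.
Qed.

(** After translation both chambers lie on the same two panels through a vertex, which
share at most one chamber. *)
Lemma turn_inj a c d : panel_of o ord0 c -> panel_of o ord0 d ->
  turn a c = turn a d -> c = d.
Proof.
move=> oc od e.
pose g := gam (ordS a) c; pose h := gam (ordS a) d.
have Gg : g^-1 \in Gamma by exact: GammaV (gamG _ _).
have Gh : h^-1 \in Gamma by exact: GammaV (gamG _ _).
have gh : g^-1 c = h^-1 d.
  apply: (adj_eq (ordS_pred_neq a)); apply/gam_panel; rewrite !gam_act //.
  by rewrite !mulVg.
have : g^-1 = h^-1.
  rewrite -[g^-1]mulg1 -[h^-1]mulg1 -{1}(gam_base ord0) ((gam_panel _ _ _).1 oc).
  by rewrite -(gam_base ord0) ((gam_panel _ _ _).1 od) -!gam_act // gh.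
by move=> ghV; rewrite ghV in gh; exact: can_inj (@aut_funK _ (h^-1)) _ _ gh.
Qed.

(** * The presentation *)

Variables (q : nat) (e : 'I_q.+1 -> X).
Hypotheses (e_panel : forall c, panel_of o ord0 c <-> exists j, e j = c).

Let v := fun a : 'I_3 => vertex_of o a.
Let S := fun a : 'I_3 => subgrp (stab Gamma (v a)).

(** The ordered difference sets: the same enumeration of the chambers of one panel is
used at all three vertices, which is what makes the triangle relations hold. *)
Definition turns (a : 'I_3) (j : 'I_q.+1) : subgrp (stab Gamma (vertex_of o a)) :=
  Sub (turn a (e j)) (turn_stab a (e j)).

Let d : forall a, 'I_q.+1 -> S a := turns.
Let R := @group_relators X Gamma v `|` @triangle_relators X Gamma v q d.
Let Gt := singer_presentation d.

Lemma stab_Gamma a (s : S a) : val s \in Gamma.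
Proof. by case/stabP: (valP s). Qed.

Definition gen_val (x : generators Gamma v) : subgrp Gamma :=
  Sub (val (tagged x)) (stab_Gamma (tagged x)).

Lemma val_word_eval a (w : word (S a)) :
  val (word_eval gen_val [seq (generator x.1, x.2) | x <- w]) = val (word_eval id w).
Proof.
elim: w => [|[s b] w ih]; first by rewrite /word_eval !big_nil.
by rewrite /= !word_eval_cons !subgrp_valM ih; congr (_ * _); case: b.
Qed.

Lemma gen_val_relator r : R r -> word_eval gen_val r = 1.
Proof.
move=> [[a [w [w1 ->]]]|[j ->]]; apply: val_inj.
  by rewrite val_word_eval w1.
rewrite /word_eval big_map enum_I3 !big_cons big_nil mulg1.
exact: (turn_prod (e j)).
Qed.

Definition eval_map : Gt -> subgrp Gamma := pres_lift gen_val (R := R).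

Lemma eval_mapM : {morph eval_map : x y / x * y}.
Proof. exact: pres_liftM gen_val_relator. Qed.

Lemma eval_map_gen a (s : S a) : val (eval_map (singer_presentation_gen d s)) = val s.
Proof. by rewrite /eval_map (pres_lift_gen gen_val_relator). Qed.

(** The generator given by g in the stabiliser of the vertex of type a; the default
value elsewhere keeps membership proofs out of the terms. *)
Definition incl (a : 'I_3) (g : aut X) : Gt :=
  singer_presentation_gen d (insubd (1 : S a) g).

Lemma incl_val a (s : S a) : incl a (val s) = singer_presentation_gen d s.
Proof. by rewrite /incl valKd. Qed.

Lemma group_relator_eq a (w : word (S a)) : word_eval id w = 1 ->
  word_eval (fun s : S a => singer_presentation_gen d s) w = 1.
Proof.
move=> w1; have : word_eq R [seq (generator x.1, x.2) | x <- w] [::].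
  rewrite -[X in word_eq _ X]cats0 -[X in word_eq _ (X)]cat0s.
  by apply: word_eq_relator; left; exists a, w.
move=> /presentedP; rewrite !pi_word_eval => e1.
transitivity (word_eval (pres_gen R) [seq (generator x.1, x.2) | x <- w]).
  by rewrite /word_eval big_map.
by rewrite e1 /word_eval big_nil.
Qed.

Lemma inclM a g h : g \in stab Gamma (v a) -> h \in stab Gamma (v a) ->
  incl a (g * h) = incl a g * incl a h.
Proof.
move=> sg sh; pose g' : S a := Sub g sg; pose h' : S a := Sub h sh.
rewrite -[g]/(val g') -[h]/(val h') -subgrp_valM !incl_val.
have := @group_relator_eq a [:: (g', true); (h', true); (g' * h', false)].
rewrite /word_eval !big_cons !big_nil /letter_eval /= !mulg1 mulgA mulgV.
move=> /(_ erefl) E; symmetry; apply: (mulIg (singer_presentation_gen d (g' * h'))^-1).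
by rewrite mulgV -mulgA.
Qed.

Lemma incl1 a : incl a 1 = 1.
Proof.
have s1 : (1 : aut X) \in stab Gamma (v a) by apply/stabP; rewrite gpred1 aut_act1.
by apply: (mulgI (incl a 1)); rewrite -inclM // !mulg1.
Qed.

Lemma inclV a g : g \in stab Gamma (v a) -> incl a g^-1 = (incl a g)^-1.
Proof.
by move=> sg; apply: (mulgI (incl a g)); rewrite -inclM ?gpredV // !mulgV incl1.
Qed.

(** Every chamber is a translate of one in the panel of type 0 of o, and translation
does not change turns, so the triangle relations apply to all chambers. *)
Lemma incl_turns c : 
  incl ord0 (turn ord0 c) * (incl (ordS ord0) (turn (ordS ord0) c) *
    incl (ord_pred ord0) (turn (ord_pred ord0) c)) = 1.
Proof.
have [j ej] : exists j, e j = (gam ord0 c)^-1 c.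
  apply/e_panel; apply/gam_panel.
  rewrite gam_base gam_act ?mulVg //.
  by rewrite gpredV.
have turnE a : turn a c = val (d a j).
  rewrite /= ej turn_act //.
  by rewrite gpredV.
rewrite !turnE !incl_val.
have : word_eq R [seq (generator (d a j), true) | a <- enum 'I_3] [::].
  rewrite -[X in word_eq _ X]cats0 -[X in word_eq _ (X)]cat0s.
  by apply: word_eq_relator; right; exists j.
move=> /presentedP; rewrite !pi_word_eval /word_eval big_map enum_I3.
by rewrite !big_cons !big_nil mulg1.
Qed.

(** The coordinates of c differ by elements of vertex stabilisers, so they can be
lifted to the presented group once one of them is. If s c is a lift of gam 0 c,
then (s c) (potential i c) is the lift of gam i c. The triangle relations say that
this does not depend on the way from 0 to i. *)
Definition potential (i : 'I_3) (c : X) : Gt :=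
  if i == ord0 then 1
  else if i == ordS ord0 then incl (ord_pred ord0) (turn (ord_pred ord0) c)
  else (incl (ordS ord0) (turn (ordS ord0) c))^-1.

Lemma potential_turn a c :
  potential (ord_pred a) c = potential (ordS a) c * incl a (turn a c).
Proof.
have SS : ordS (ordS ord0) = ord_pred ord0 :> 'I_3 by exact: val_inj.
have SP : ordS (ord_pred ord0) = ord0 :> 'I_3 by exact: val_inj.
have PS : ord_pred (ordS ord0) = ord0 :> 'I_3 by exact: val_inj.
have PP : ord_pred (ord_pred ord0) = ordS ord0 :> 'I_3 by exact: val_inj.
have [->|a0] := eqVneq a ord0.
  rewrite /potential /=; have := incl_turns c.
  set x := incl _ _; set y := incl _ _; set z := incl _ _ => xyz.
  apply: (mulgI y); rewrite mulgV; apply: (mulgI x); rewrite mulg1 !mulgA.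
  by rewrite -(mulgA x) xyz mul1g.
have [->|->] := neq_ord3 a0.
  by rewrite PS SS /potential /= mulVg.
by rewrite PP SP /potential /= mul1g.
Qed.

Lemma potential_step i j a c : i != a -> j != a ->
  potential j c = potential i c * incl a ((gam i c)^-1 * gam j c).
Proof.
move=> ia ja; have st := turn_stab a c.
have [->|->] := neq_ord3 ia; have [->|->] := neq_ord3 ja.
- by rewrite mulVg incl1 mulg1.
- exact: potential_turn.
- have -> : (gam (ord_pred a) c)^-1 * gam (ordS a) c = (turn a c)^-1.
    by rewrite /turn invgM invgK.
  by rewrite inclV // potential_turn mulgK.
- by rewrite mulVg incl1 mulg1.
Qed.

(** How the lift s c of gam 0 c has to change between two chambers with a common
vertex of type a: there the coordinates of type other than a differ by elements of
the stabiliser. *)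
Definition holonomy (a : 'I_3) (c d : X) : Gt :=
  potential (ordS a) c * incl a ((gam (ordS a) c)^-1 * gam (ordS a) d) *
    (potential (ordS a) d)^-1.

(** Another coordinate of type other than a changes the outer and the inner factors
by the same elements of the stabiliser, which cancel by potential_step. *)
Lemma holonomyE i a c c' : i != a -> vertex_of c a c' ->
  holonomy a c c' = potential i c * incl a ((gam i c)^-1 * gam i c') *
    (potential i c')^-1.
Proof.
move=> ia cc'; have Sa := ordS_neq a; have rf := residue_refl.
rewrite /holonomy (potential_step c Sa ia) (potential_step c' Sa ia).
pose B := (gam (ordS a) c)^-1 * gam i c; pose D := (gam (ordS a) c')^-1 * gam i c'.
pose C := (gam i c)^-1 * gam i c'.
have -> : (gam (ordS a) c)^-1 * gam (ordS a) c' = B * C * D^-1.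
  by rewrite /B /C /D invgM invgK -!mulgA !mulVKg.
have sB : B \in stab Gamma (v a) by apply: gam_stab => //; exact: rf.
have sC : C \in stab Gamma (v a) by exact: gam_stab cc'.
have sD : D \in stab Gamma (v a) by apply: gam_stab => //; exact: rf.
have sBC : B * C \in stab Gamma (v a) by rewrite gpredM.
have sDV : D^-1 \in stab Gamma (v a) by rewrite gpredV.
by rewrite (inclM sBC sDV) (inclM sB sC) (inclV sD) [in RHS]invgM !mulgA.
Qed.

Lemma holonomyM a c c1 c2 : vertex_of c a c1 -> vertex_of c a c2 ->
  holonomy a c c1 * holonomy a c1 c2 = holonomy a c c2.
Proof.
move=> cc1 cc2; have Sa := ordS_neq a; rewrite /holonomy.
have c12 : vertex_of c1 a c2 by apply: vertex_trans cc2; exact: vertex_sym.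
rewrite -!mulgA mulKg; congr (_ * _); rewrite mulgA -inclM; try exact: gam_stab.
by rewrite -!mulgA mulVKg.
Qed.

Lemma holonomy_panel i a b c c' : i != a -> i != b -> panel_of c i c' ->
  holonomy a c c' = holonomy b c c'.
Proof.
move=> ia ib cc'.
rewrite (holonomyE ia (adj_vertex ia cc')) (holonomyE ib (adj_vertex ib cc')).
by rewrite ((gam_panel i c c').1 cc') mulVg !incl1.
Qed.

(** By connectedness: adjacent chambers share a coordinate, and their others differ
from it by elements of vertex stabilisers. *)
Lemma eval_map_surj g : g \in Gamma -> exists x, val (eval_map x) = g.
Proof.
pose im g := exists x, val (eval_map x) = g.
have imM g1 g2 : im g1 -> im g2 -> im (g1 * g2).
  by move=> [x <-] [y <-]; exists (x * y); rewrite eval_mapM subgrp_valM.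
have im_stab a g1 : g1 \in stab Gamma (v a) -> im g1.
  move=> sg; exists (singer_presentation_gen d (Sub g1 sg : S a)).
  exact: eval_map_gen.
suff H c : forall i, im (gam i c) by move=> Gg; have := H (g o) ord0; rewrite gam_orbit.
apply: (building_ind (c := o) (Q := fun c => forall i, im (gam i c))); last first.
  by move=> i; rewrite gam_base; apply: (im_stab ord0); rewrite gpred1.
move=> m x y xy ih i; have [->|im_] := eqVneq i m.
  by rewrite -((gam_panel m x y).1 xy).
have [a ia ma] := other_type i m.
have -> : gam i y = gam m x * ((gam m y)^-1 * gam i y).
  by rewrite ((gam_panel m x y).1 xy) mulVKg.
apply: imM => //; apply: (im_stab a); apply: gam_stab => //; exact: residue_refl.
Qed.

Lemma pi_generator (x : generators Gamma v) :
  pres_gen R x = incl (tag x) (val (tagged x)).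
Proof. by case: x => a s; rewrite incl_val. Qed.

(** The holonomy is trivialised by some s. Then L g = s (g o) satisfies
L (g h) = (L g) (incl a h) for h in the stabiliser of the vertex of type a, so it
turns every word evaluating to g in Gamma back into the element it presents. *)
Lemma eval_map_bij : bijective eval_map.
Proof.
have [s [so sM]] := trivial_cocycle o holonomyM holonomy_panel.
(* All coordinates of g o are equal to g, so no correction is needed there. *)
have pot g i : g \in Gamma -> potential i (g o) = 1.
  move=> Gg; rewrite /potential !turn_act // !turn_base !incl1 invg1.
  by do 2?[case: ifP => // _].
pose L (g : aut X) := s (g o).
have LM a g h : g \in Gamma -> h \in stab Gamma (v a) -> L (g * h) = L g * incl a h.
  move=> Gg sh; have [Gh hv] := stabP _ _ _ sh; have Ggh := GammaM Gg Gh.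
  have gv : vertex_of (g o) a ((g * h) o).
    by apply/residue_eq; rewrite -![residue _ _]Gtyped_vertex // aut_actM hv.
  rewrite /L (sM a _ _ gv) (holonomyE (ordS_neq a) gv) !pot // invg1 mulg1 mul1g.
  by rewrite !gam_orbit // mulKg.
have Lw w g : g \in Gamma ->
    L (g * val (word_eval gen_val w)) = L g * word_eval (pres_gen R) w.
  elim: w g => [|[x b] w ih] g Gg; first by rewrite /word_eval !big_nil !mulg1.
  rewrite !word_eval_cons subgrp_valM !mulgA.
  have sx : val (tagged x) \in stab Gamma (v (tag x)) := valP (tagged x).
  have sb : val (letter_eval gen_val (x, b)) \in stab Gamma (v (tag x)).
    by case: b => //=; rewrite gpredV.
  rewrite ih; last by apply: GammaM => //; exact: valP.
  congr (_ * _); rewrite (LM (tag x)) //; congr (_ * _).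
  case: b {sb} => /=; rewrite /letter_eval /= pi_generator //.
  by rewrite inclV.
have LK : cancel eval_map (fun g => L (val g)).
  elim/quotW=> w; rewrite /eval_map (pres_lift_pi gen_val_relator) -[val _]mul1g.
  by rewrite Lw ?gpred1 // /L so mul1g pi_word_eval.
exists (fun g => L (val g)) => // g.
by have [x e_] := eval_map_surj (valP g); apply: val_inj; rewrite -e_ LK.
Qed.

End PanelCoordinates.

Theorem theorem10p3p6 (R : realType) (X : building)
    (Gamma : groupClosed (aut X)) :
  thick X -> locally_finite X ->
  lattice R Gamma -> (exists i, panel_regular Gamma i) ->
  exists q : nat,
    (forall a u, vertices X a u -> projective_plane (link a u) q) /\
  exists v : 'I_3 -> set X,
    [/\ forall a, vertices X a (v a),
        forall a, singer_group (link a (v a)) (@stab_act X Gamma (v a))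
      & exists d : forall a, 'I_q.+1 -> subgrp (stab Gamma (v a)),
        [/\ forall a, ordered_difference_set (link a (v a))
                        (@stab_act X Gamma (v a)) (d a),
            forall a, d a ord0 = 1
          & exists f : {multiplicative singer_presentation d -> subgrp Gamma},
              bijective f /\
              forall a (s : subgrp (stab Gamma (v a))),
                val (f (singer_presentation_gen d s)) = val s]].
Proof.
move=> th lf _ [i reg]; have [q unif] := uniform_of_regular reg lf.
have typed := type_preserving reg th lf.
have regT j : panel_regular Gamma j := regular_other th lf typed j reg.
exists q; split=> [a u au|].
  exact: vertex_plane_projective th unif (ordS_pred_neq a) (ordS_neq a) (ord_pred_neq a) au.
case: (chamber_inhabited X) => o; exists (fun a => vertex_of o a).
have ov a : vertices X a (vertex_of o a) by exists o.
split=> // [a|]; first exact: stab_singer typed (ordS a) _ _ _ (regT _) (ordS_neq a) (ov a).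
have free g j : g \in Gamma -> aut_act g (panel_of o j) = panel_of o j -> g = 1.
  have [_ _ fr] := (panel_regularP _ _).1 (regT j).
  by move=> Gg; apply: fr => //; exists o.
have /choice[gam gamGP] : forall j, exists gam : X -> aut X, forall c,
    gam c \in Gamma /\ aut_act (gam c) (panel_of o j) = panel_of c j.
  move=> j; have [_ tr _] := (panel_regularP _ _).1 (regT j).
  have /choice[gam gamP] : forall c, exists g : aut X,
      g \in Gamma /\ aut_act g (panel_of o j) = panel_of c j.
    by move=> c; have [||g Gg e] := tr (panel_of o j) (panel_of c j);
      [exists o | exists c | exists g].
  by exists gam.
have gamG j c : gam j c \in Gamma by case: (gamGP j c).
have gamP j c : aut_act (gam j c) (panel_of o j) = panel_of c j by case: (gamGP j c).
have [f [finj fP]] := (card_enum _ _).1 (unif ord0 o).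
have [j0 fj0] := (fP o).1 (panel_refl _ o).
(* The chamber o gets the index 0, so that the ordered difference sets start at 1. *)
pose e j := f (tperm ord0 j0 j).
have e_panel c : panel_of o ord0 c <-> exists j, e j = c.
  rewrite fP; split=> -[j <-]; last by exists (tperm ord0 j0 j).
  by exists (tperm ord0 j0 j); rewrite /e tpermK.
have einj : injective e by move=> j k /finj /perm_inj.
have e0 : e ord0 = o by rewrite /e tpermL.
have oe j : panel_of o ord0 (e j) by apply/e_panel; exists j.
exists (turns typed gamG gamP e); split=> [a|a|].
- exists (panel_of o (ordS a)), (panel_of o (ord_pred a)); split.
  + by split; [exists o | by move=> c; apply: adj_vertex; exact: ordS_neq].
  + by split; [exists o | by move=> c; apply: adj_vertex; exact: ord_pred_neq].
  + have D s := turn_difference typed free gamG gamP (a := a) (valP s).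
    split=> [j _|j k _ _ /(congr1 val) /= jk|s /D[c oc es]].
    * by apply/D; exists (e j).
    * exact/einj/(turn_inj typed free gamG gamP (oe j) (oe k) jk).
    * have [j ej] := (e_panel c).1 oc; exists j => //.
      by apply: val_inj; rewrite /= ej.
- by apply: val_inj; rewrite /= e0 (turn_base free gamG gamP).
pose F := eval_map (typed := typed) (gamG := gamG) (gamP := gamP) (e := e).
pose m := isMultiplicative.Build _ _ F
  (eval_mapM (typed := typed) (gamG := gamG) (gamP := gamP) (e := e)).
pose fF : {multiplicative singer_presentation (turns typed gamG gamP e) -> subgrp Gamma}
  := HB.pack F m.
exists fF; split.
  exact: (eval_map_bij typed free gamG gamP e_panel).
by move=> a s; exact: eval_map_gen.
Qed.
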